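(* Given a streaming data-string transducer $S$ from $\Sigma$ to $\Sigma$, one can effectively construct a single-pass list processing function $f$ such that $[\![S]\!]=[\![f]\!]$.
   Context: Fix a totally ordered, possibly infinite, set $D$ of data values, with strict order $<$. A data string over a finite set $\Sigma$ of tags is a finite sequence of pairs in $\Sigma\times D$. SDSTs. A (deterministic) streaming data-string transducer (SDST) from $\Sigma$ to $\Gamma$ consists of: a finite set $Q$ of states; an initial state $q_0$; a finite set $V$ of data variables with a distinguished $curr\in V$; a finite set $X$ of data string variables; a partial output function $O$ from $Q$ to $((\Gamma\times V)\cup X)^*$; a finite set of transitions $(q,\sigma,\varphi,q',\alpha)$ with $q,q'\in Q$, $\sigma\in\Sigma$, $\varphi$ a Boolean formula over atoms $v<curr$, $curr<v$ ($v\in V$), and $\alpha$ mapping $V$ to $V$ and $X$ to $((\Gamma\times V)\cup X)^*$; such that (1) each $x\in X$ occurs at most once in each $O(q)$; (2) for each transition each $x\in X$ occurs at most once in total in the strings $\{\alpha(y)\mid y\in X\}$; (3) distinct transitions with the same source and tag have jointly unsatisfiable tests. A valuation $\beta$ is a partial map sending data variables to $D$, data string variables to data strings over $\Gamma$; tests and strings are evaluated under $\beta$ by substitution and are undefined if some variable occurring in them is undefined. The initial configuration is $(q_0,\beta_0)$ with data variables undefined and data string variables empty. On a symbol $(\sigma,d)$, with $\beta'=\beta[curr\mapsto d]$, a transition $(q,\sigma,\varphi,q',\alpha)$ with $\beta'(\varphi)=1$ gives $(q,\beta)\to(q',\beta'\cdot\alpha)$, where $(\beta'\cdot\alpha)(z)=\beta'(\alpha(z))$.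 If $w$ leads from $(q_0,\beta_0)$ to $(q,\beta)$ and $O(q)$ is defined, $[\![S]\!](w)=\beta(O(q))$; otherwise $[\![S]\!](w)$ is undefined. Functional language. A simply typed functional language with types bool, tag ($=\Sigma$), data ($=D$), list (lists of elements of type tag $\times$ data), products and function types. Terms: true, false, isTrue $t$, isFalse $t$; a constant $s$ and a test $\mathrm{is}_s$ for each $s\in\Sigma$; variables; $\mathrm{fun}\ x{:}T.\,t$; application; if-then-else; $x=x$ and $x<x$ on data; pairs $\{t,t\}$ and projections $t.1,t.2$; nil, cons $t\,t$, append $t\,t$, isnil $t$, head $t$, tail $t$; let $x=t$ in $t$; letrec $x{:}T=t$ in $t$. Typing and the evaluation relation $\to$ are standard. A single-pass list processing function is one defined by a term $$\mathrm{fun}\ a{:}\mathrm{list}\times T_1.\ \ \mathrm{letrec}\ g{:}((\mathrm{list}\times T_1\times T_2)\to(\mathrm{list}\times T))=t\ \ \mathrm{in}\ (g\ a\ initValues)$$ satisfying the following. (One list) Let $l$ be the first argument of $g$; it is the only list accessed by isnil, head, tail (other list variables may be used with cons and append). (Types) $T_1$ and $T$ are products of types bool, tag, data; $T_2$ is a product of types bool, tag, data, list (possibly several components of each type). (Recursion) The first argument of any recursive call is (tail $l$). Every recursive call is enclosed in an expression $e$ of the form let $r=(g\ (\mathrm{tail}\ l)\ a)$ in $t$, and $e$ is the last expression the caller evaluates, i.e. $t$ is the caller's result. Writing $r\equiv l_1,r_1,\dots,r_n$, $a\equiv a_1\dots a_n$, $t\equiv l_2,t_1,\dots,t_n$, where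 $l_1$ is a list, $l_2$ is a list expression, the $r_i$ and $t_i$ have type bool, tag or data, and the $a_i$ have type bool, tag, data or list: (i) a list variable of $g$ can appear in at most one expression $a_i$ or $t_j$; (ii) if $t_i$ is of type bool, the only variable of $r$ it can use is $r_i$; (iii) if $t_i$ is of type tag or data, then $t_i=r_i$; (iv) the only variable of $r$ that $l_2$ can use is $l_1$. (Body) The term defining $g$ is of the form $\mathrm{fun}\ x{:}(\mathrm{list}\times T_1\times T_2).\,t'$, where $t'$ contains neither fun nor letrec. (Initial values) $initValues$ has type $T_2$, and its components of type list are nil. The transduction $[\![f]\!]$. If $T_1$ has $k_i$ components, the first $k_i$ symbols of an input data string $w$ encode the $k_i$ boolean/data/tag arguments ($decode\_param(w)$), and the rest, viewed as a term of type list, is the input list ($decode\_list(w)$). Similarly a result tuple $\{l_1,r_1,\dots,r_n\}$ of type list $\times\,T$ is encoded as a data string $enc\_res(\{l_1,r_1,\dots,r_n\})$ by prefixing the list $l_1$ with one symbol per returned value $r_i$. Then $[\![f]\!](w)=w'$ iff $(f\ decode\_list(w)\ decode\_param(w))\to^*\{l_1,r_1,\dots,r_n\}$ and $enc\_res(\{l_1,r_1,\dots,r_n\})=w'$. In particular, when there are no extra arguments or returned values, $[\![f]\!]$ maps the input list to the output list. *)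

(* Defs.v *)
From HB Require Import structures.
From mathcomp Require Import all_boot all_order.
From Stdlib Require List Relation_Operators.

Set Implicit Arguments.
Unset Strict Implicit.
Unset Printing Implicit Defensive.

Definition upd {A : Type} (f : nat -> A) (x : nat) (a : A) : nat -> A :=
  fun y => if y == x then a else f y.

(** * Streaming data-string transducers *)

Inductive test (V : Type) : Type :=
| Btrue | Bfalse
| Blt_curr of V          (* v < curr *)
| Bcurr_lt of V          (* curr < v *)
| Bnot of test V
| Band of test V & test V
| Bor of test V & test V.

(* Letters of the strings over (Ga * V) + X used in outputs and assignments. *)
Definition item (Ga V X : Type) : Type := ((Ga * V) + X)%type.

Record transition (Sg Ga Q V X : finType) := Transition {
  src : Q;
  lab : Sg;
  guard : test V;
  dst : Q;
  asgn_data : {ffun V -> V};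
  asgn_str : {ffun X -> seq (item Ga V X)}
}.

Record sdst (Sg Ga : finType) := Sdst {
  state : finType;
  init_state : state;
  dvar : finType;
  curr : dvar;
  svar : finType;
  out : {ffun state -> option (seq (item Ga dvar svar))};
  trans : seq (transition Sg Ga state dvar svar)
}.

Section SdstSemantics.
Context {Sg Ga : finType} {disp : Order.disp_t} (D : orderType disp).

(* Value of a test under a partial valuation: undefined as soon as one of the
   variables occurring in the test is. *)
Fixpoint eval_test (V : finType) (cur : V) (b : V -> option D) (phi : test V)
    : option bool :=
  match phi with
  | Btrue => Some true
  | Bfalse => Some false
  | Blt_curr v => if (b v, b cur) is (Some d, Some c) then Some (d < c)%O else None
  | Bcurr_lt v => if (b v, b cur) is (Some d, Some c) then Some (c < d)%O else None
  | Bnot p => omap negb (eval_test cur b p)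
  | Band p q => if (eval_test cur b p, eval_test cur b q) is (Some i, Some j)
                then Some (i && j) else None
  | Bor p q => if (eval_test cur b p, eval_test cur b q) is (Some i, Some j)
               then Some (i || j) else None
  end.

Variable S : sdst Sg Ga.

Definition is_svar (x : svar S) (i : item Ga (dvar S) (svar S)) : bool :=
  if i is inr y then y == x else false.

Definition sdst_wf : Prop :=
  [/\ forall q s, out S q = Some s -> forall x, count (is_svar x) s <= 1,
      forall t, List.In t (trans S) ->
        forall x, \sum_(y : svar S) count (is_svar x) (asgn_str t y) <= 1
    & forall t1 t2, List.In t1 (trans S) -> List.In t2 (trans S) -> t1 <> t2 ->
        src t1 = src t2 -> lab t1 = lab t2 ->
        forall b : dvar S -> option D,
          ~ (eval_test (curr S) b (guard t1) = Some true /\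
             eval_test (curr S) b (guard t2) = Some true)].

Record valuation := Valuation {
  dval : dvar S -> option D;
  sval : svar S -> option (seq (Ga * D))
}.

Definition init_valuation : valuation :=
  Valuation (fun _ => None) (fun _ => Some [::]).

Definition set_curr (b : valuation) (d : D) : valuation :=
  Valuation (fun v => if v == curr S then Some d else dval b v) (sval b).

Definition eval_item (b : valuation) (i : item Ga (dvar S) (svar S))
    : option (seq (Ga * D)) :=
  match i with
  | inl (c, v) => omap (fun d => [:: (c, d)]) (dval b v)
  | inr x => sval b x
  end.

Fixpoint eval_str (b : valuation) (s : seq (item Ga (dvar S) (svar S)))
    : option (seq (Ga * D)) :=
  if s is i :: s' then
    if (eval_item b i, eval_str b s') is (Some u, Some u') then Some (u ++ u')
    else None
  else Some [::].

Definition apply_asgn (b : valuation)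
    (t : transition Sg Ga (state S) (dvar S) (svar S)) : valuation :=
  Valuation (fun v => dval b (asgn_data t v)) (fun x => eval_str b (asgn_str t x)).

Inductive sdst_step :
    state S -> valuation -> Sg * D -> state S -> valuation -> Prop :=
| SdstStep t b d :
    List.In t (trans S) ->
    eval_test (curr S) (dval (set_curr b d)) (guard t) = Some true ->
    sdst_step (src t) b (lab t, d) (dst t) (apply_asgn (set_curr b d) t).

Inductive sdst_run :
    state S -> valuation -> seq (Sg * D) -> state S -> valuation -> Prop :=
| SdstRun0 q b : sdst_run q b [::] q b
| SdstRunS q b a q1 b1 w q2 b2 :
    sdst_step q b a q1 b1 -> sdst_run q1 b1 w q2 b2 ->
    sdst_run q b (a :: w) q2 b2.

(* Graph of the partial function [[S]]. *)
Definition sdst_sem (w : seq (Sg * D)) (w' : seq (Ga * D)) : Prop :=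
  exists q b s,
    [/\ sdst_run (init_state S) init_valuation w q b,
        out S q = Some s & eval_str b s = Some w'].

End SdstSemantics.

(** * The functional language *)

Inductive ty : Type :=
| TBool | TTag | TData | TList
| TProd of ty & ty
| TArr of ty & ty.

(* CData d is a data value: it arises from input lists, and is not part of the
   source syntax of the language (see source below). *)
Inductive const (Sg D : Type) : Type :=
| CBool of bool
| CTag of Sg
| CData of D.
Arguments CBool {Sg D}.
Arguments CTag {Sg D}.
Arguments CData {Sg D}.

Inductive term (Sg D : Type) : Type :=
| tVar of nat
| tConst of const Sg D
| tIsTrue of term Sg D
| tIsFalse of term Sg D
| tIsTag of Sg & term Sg D
| tFun of nat & ty & term Sg D
| tApp of term Sg D & term Sg D
| tIf of term Sg D & term Sg D & term Sg D
| tEq of term Sg D & term Sg D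
| tLt of term Sg D & term Sg D
| tPair of term Sg D & term Sg D
| tFst of term Sg D
| tSnd of term Sg D
| tNil
| tCons of term Sg D & term Sg D
| tAppend of term Sg D & term Sg D
| tIsNil of term Sg D
| tHead of term Sg D
| tTail of term Sg D
| tLet of nat & term Sg D & term Sg D
| tLetrec of nat & ty & term Sg D & term Sg D.
Arguments tVar {Sg D}.
Arguments tNil {Sg D}.

Section Language.
Context {Sg : finType} {disp : Order.disp_t} {D : orderType disp}.
Notation tm := (term Sg D).
Implicit Types t u v w : tm.

Definition const_ty (c : const Sg D) : ty :=
  match c with CBool _ => TBool | CTag _ => TTag | CData _ => TData end.

Inductive has_type : (nat -> option ty) -> tm -> ty -> Prop :=
| HT_var G x T : G x = Some T -> has_type G (tVar x) T
| HT_const G c : has_type G (tConst c) (const_ty c)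
| HT_istrue G t : has_type G t TBool -> has_type G (tIsTrue t) TBool
| HT_isfalse G t : has_type G t TBool -> has_type G (tIsFalse t) TBool
| HT_istag G s t : has_type G t TTag -> has_type G (tIsTag s t) TBool
| HT_fun G x T U t :
    has_type (upd G x (Some T)) t U -> has_type G (tFun x T t) (TArr T U)
| HT_app G T U t u :
    has_type G t (TArr T U) -> has_type G u T -> has_type G (tApp t u) U
| HT_if G T c t u :
    has_type G c TBool -> has_type G t T -> has_type G u T ->
    has_type G (tIf c t u) T
| HT_eq G t u :
    has_type G t TData -> has_type G u TData -> has_type G (tEq t u) TBool
| HT_lt G t u :
    has_type G t TData -> has_type G u TData -> has_type G (tLt t u) TBool
| HT_pair G T U t u :
    has_type G t T -> has_type G u U -> has_type G (tPair t u) (TProd T U)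
| HT_fst G T U t : has_type G t (TProd T U) -> has_type G (tFst t) T
| HT_snd G T U t : has_type G t (TProd T U) -> has_type G (tSnd t) U
| HT_nil G : has_type G tNil TList
| HT_cons G t u :
    has_type G t (TProd TTag TData) -> has_type G u TList ->
    has_type G (tCons t u) TList
| HT_append G t u :
    has_type G t TList -> has_type G u TList -> has_type G (tAppend t u) TList
| HT_isnil G t : has_type G t TList -> has_type G (tIsNil t) TBool
| HT_head G t : has_type G t TList -> has_type G (tHead t) (TProd TTag TData)
| HT_tail G t : has_type G t TList -> has_type G (tTail t) TList
| HT_let G x T U t u :
    has_type G t T -> has_type (upd G x (Some T)) u U ->
    has_type G (tLet x t u) U
| HT_letrec G x T U t u :
    has_type (upd G x (Some T)) t T -> has_type (upd G x (Some T)) u U ->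
    has_type G (tLetrec x T t u) U.

Fixpoint is_value t : bool :=
  match t with
  | tConst _ | tNil | tFun _ _ _ => true
  | tPair u v | tCons u v => is_value u && is_value v
  | _ => false
  end.

(* Only closed terms are substituted, so no renaming is needed. *)
Fixpoint subst (x : nat) (s : tm) t : tm :=
  let S := subst x s in
  match t with
  | tVar y => if y == x then s else t
  | tConst _ | tNil => t
  | tIsTrue u => tIsTrue (S u)
  | tIsFalse u => tIsFalse (S u)
  | tIsTag c u => tIsTag c (S u)
  | tFun y T u => tFun y T (if y == x then u else S u)
  | tApp u v => tApp (S u) (S v)
  | tIf u v w => tIf (S u) (S v) (S w)
  | tEq u v => tEq (S u) (S v)
  | tLt u v => tLt (S u) (S v)
  | tPair u v => tPair (S u) (S v)
  | tFst u => tFst (S u)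
  | tSnd u => tSnd (S u)
  | tCons u v => tCons (S u) (S v)
  | tAppend u v => tAppend (S u) (S v)
  | tIsNil u => tIsNil (S u)
  | tHead u => tHead (S u)
  | tTail u => tTail (S u)
  | tLet y u v => tLet y (S u) (if y == x then v else S v)
  | tLetrec y T u v =>
      if y == x then t else tLetrec y T (S u) (S v)
  end.

Notation tbool b := (@tConst Sg D (CBool b)).

(* Call-by-value redexes. *)
Inductive red : tm -> tm -> Prop :=
| R_istrue b : red (tIsTrue (tbool b)) (tbool b)
| R_isfalse b : red (tIsFalse (tbool b)) (tbool (~~ b))
| R_istag s s' : red (tIsTag s (tConst (CTag s'))) (tbool (s' == s))
| R_app x T t v : is_value v -> red (tApp (tFun x T t) v) (subst x v t)
| R_iftrue t u : red (tIf (tbool true) t u) t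
| R_iffalse t u : red (tIf (tbool false) t u) u
| R_eq d e : red (tEq (tConst (CData d)) (tConst (CData e))) (tbool (d == e))
| R_lt d e : red (tLt (tConst (CData d)) (tConst (CData e))) (tbool (d < e)%O)
| R_fst u v : is_value u -> is_value v -> red (tFst (tPair u v)) u
| R_snd u v : is_value u -> is_value v -> red (tSnd (tPair u v)) v
| R_append_nil v : is_value v -> red (tAppend tNil v) v
| R_append_cons u v w : is_value u -> is_value v -> is_value w ->
    red (tAppend (tCons u v) w) (tCons u (tAppend v w))
| R_isnil_nil : red (tIsNil tNil) (tbool true)
| R_isnil_cons u v : is_value u -> is_value v ->
    red (tIsNil (tCons u v)) (tbool false)
| R_head u v : is_value u -> is_value v -> red (tHead (tCons u v)) u
| R_tail u v : is_value u -> is_value v -> red (tTail (tCons u v)) v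
| R_let x v u : is_value v -> red (tLet x v u) (subst x v u)
| R_letrec x T t u : red (tLetrec x T t u) (subst x (tLetrec x T t t) u).

(* One-hole evaluation frames, left to right. *)
Inductive frame : Type :=
| F_istrue | F_isfalse | F_istag of Sg
| F_appl of tm | F_appr of tm
| F_if of tm & tm
| F_eql of tm | F_eqr of tm
| F_ltl of tm | F_ltr of tm
| F_pairl of tm | F_pairr of tm
| F_fst | F_snd
| F_consl of tm | F_consr of tm
| F_appendl of tm | F_appendr of tm
| F_isnil | F_head | F_tail
| F_let of nat & tm.

Definition frame_ok (F : frame) : bool :=
  match F with
  | F_appr v | F_eqr v | F_ltr v | F_pairr v | F_consr v | F_appendr v =>
      is_value v
  | _ => true
  end.

Definition plug (F : frame) (t : tm) : tm :=
  match F with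
  | F_istrue => tIsTrue t
  | F_isfalse => tIsFalse t
  | F_istag s => tIsTag s t
  | F_appl u => tApp t u
  | F_appr v => tApp v t
  | F_if u w => tIf t u w
  | F_eql u => tEq t u
  | F_eqr v => tEq v t
  | F_ltl u => tLt t u
  | F_ltr v => tLt v t
  | F_pairl u => tPair t u
  | F_pairr v => tPair v t
  | F_fst => tFst t
  | F_snd => tSnd t
  | F_consl u => tCons t u
  | F_consr v => tCons v t
  | F_appendl u => tAppend t u
  | F_appendr v => tAppend v t
  | F_isnil => tIsNil t
  | F_head => tHead t
  | F_tail => tTail t
  | F_let x u => tLet x t u
  end.

Inductive step : tm -> tm -> Prop :=
| Step_red t u : red t u -> step t u
| Step_frame F t u : frame_ok F -> step t u -> step (plug F t) (plug F u).

Definition steps : tm -> tm -> Prop :=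
  Relation_Operators.clos_refl_trans_1n tm step.

(* A product with a distinguished first component is nested to the left,
   {{l, t_1}, ..., t_n}; with no further component it is just that component.
   In particular (list * T1) * T2 extends list * T1. *)
Definition tprod (T : ty) (Ts : seq ty) : ty := foldl TProd T Ts.
Definition tm_tuple (t : tm) (ts : seq tm) : tm := foldl (@tPair Sg D) t ts.

Fixpoint fold_term (A : Type) (f : tm -> seq A -> A) (t : tm) : A :=
  let F := fold_term f in
  f t (match t with
       | tVar _ | tConst _ | tNil => [::]
       | tIsTrue u | tIsFalse u | tIsTag _ u | tFun _ _ u | tFst u | tSnd u
       | tIsNil u | tHead u | tTail u => [:: F u]
       | tApp u v | tEq u v | tLt u v | tPair u v | tCons u v | tAppend u v
       | tLet _ u v | tLetrec _ _ u v => [:: F u; F v]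
       | tIf u v w => [:: F u; F v; F w]
       end).

Definition all_subterms (p : pred tm) : pred tm :=
  fold_term (fun t bs => p t && all id bs).

(* Union of leaf over the outermost subterms on which it is defined. *)
Definition collect (A : Type) (leaf : tm -> option (seq A)) : tm -> seq A :=
  fold_term (fun t ss => if leaf t is Some s then s else flatten ss).

(** ** Single-pass list processing functions *)

(* When variable z denotes a tuple with components 0, ..., n, as_comp z n t is
   Some k iff t is the projection denoting component k, i.e. z.1 ... .1 (n
   times) for k = 0 and z.1 ... .1.2 (n - k times .1) for k > 0. *)
Fixpoint fst_depth (z : nat) t : option nat :=
  match t with
  | tVar y => if y == z then Some 0 else None
  | tFst u => omap succn (fst_depth z u)
  | _ => None
  end.

Definition as_comp (z n : nat) t : option nat :=
  match t with
  | tSnd u => if fst_depth z u is Some i then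
                if i < n then Some (n - i) else None
              else None
  | _ => if fst_depth z t == Some n then Some 0 else None
  end.

(* Components of z that t uses; an occurrence of z that is not part of a
   projection to one component uses all of them. *)
Definition comp_leaf (z n : nat) t : option (seq nat) :=
  if as_comp z n t is Some k then Some [:: k]
  else if t is tVar y then Some (if y == z then iota 0 n.+1 else [::])
  else None.

Definition comps_used (z n : nat) : tm -> seq nat := collect (comp_leaf z n).

(* The same, where rho y lists the components carried by a let-bound y. *)
Definition comps_in (z n : nat) (rho : nat -> seq nat) : tm -> seq nat :=
  collect (fun t => if comp_leaf z n t is Some ks
                    then if t is tVar y then Some (ks ++ rho y) else Some ks
                    else None).

(* Components that can flow into the value of t; the value of isnil or head
   contains no list. *)
Definition comps_carried (z n : nat) (rho : nat -> seq nat) : tm -> seq nat :=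
  collect (fun t => match t with
                    | tIsNil _ | tHead _ => Some [::]
                    | _ => if comp_leaf z n t is Some ks
                           then if t is tVar y then Some (ks ++ rho y) else Some ks
                           else None
                    end).

Definition is_list (T : ty) : bool := if T is TList then true else false.
Definition is_scalar (T : ty) : bool :=
  match T with TBool | TTag | TData => true | _ => false end.

Definition free_of (g : nat) : pred tm :=
  all_subterms (fun u => if u is tVar y then y != g else true).

Definition binds_no (x : nat) : pred tm :=
  all_subterms (fun u => if u is tLet y _ _ then y != x else true).

Definition source t : bool :=
  all_subterms (fun u => if u is tConst (CData _) then false else true) t.

Definition no_fun_letrec t : bool :=
  all_subterms (fun u => match u with
                         | tFun _ _ _ | tLetrec _ _ _ _ => false
                         | _ => true end) t.

(* Component 0 of x is the list l. *)
Definition one_list (x n : nat) t : bool :=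
  all_subterms (fun u => match u with
                         | tIsNil v | tHead v | tTail v => as_comp x n v == Some 0
                         | _ => true end) t.

(* The result {l2, t_1, ..., t_m} computed from the variable r holding the
   result of the recursive call; t_i is nth tNil ts (i - 1). *)
Definition result_ok (r : nat) (T : seq ty) (l2 : tm) (ts : seq tm) : Prop :=
  let m := size T in
  [/\ size ts = m,
      all (binds_no r) (l2 :: ts),
      {subset comps_used r m l2 <= [:: 0]}
    & forall i, i < m ->
        let t := nth tNil ts i in
        if nth TList T i is TBool
        then {subset comps_used r m t <= [:: i.+1]}
        else as_comp r m t = Some i.+1].

(* Every use of g is a call
   let r = g {tail l, a_1, ..., a_n} in {l2, t_1, ..., t_m} in tail position.
   Ts = T1 ++ T2 are the types of the components 1, ..., n of x.  A let-bound
   name counts as an occurrence of the list variables its value carries. *)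
Inductive single_calls (x g : nat) (Ts T : seq ty) :
    (nat -> seq nat) -> tm -> Prop :=
| SC_plain rho t : free_of g t -> single_calls x g Ts T rho t
| SC_if rho c t u :
    free_of g c -> single_calls x g Ts T rho t -> single_calls x g Ts T rho u ->
    single_calls x g Ts T rho (tIf c t u)
| SC_let rho y t u :
    free_of g t ->
    single_calls x g Ts T (upd rho y (comps_carried x (size Ts) rho t)) u ->
    single_calls x g Ts T rho (tLet y t u)
| SC_call rho r l args l2 ts :
    as_comp x (size Ts) l = Some 0 ->
    size args = size Ts ->
    all (free_of g) args -> all (free_of g) (l2 :: ts) ->
    result_ok r T l2 ts ->
    (forall k, k <= size Ts -> is_list (nth TBool (TList :: Ts) k) ->
      count (fun e => k \in comps_in x (size Ts) rho e) args +
      count (fun e => k \in comps_in x (size Ts) (upd rho r [::]) e) (l2 :: ts)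
        <= 1) ->
    single_calls x g Ts T rho
      (tLet r (tApp (tVar g) (tm_tuple (tTail l) args)) (tm_tuple l2 ts)).

(* As the language has no data constants, an initial value of type data is an
   element of D used as a value. *)
Definition init_value (T : ty) (v : tm) : Prop :=
  if is_list T then v = tNil else exists2 c, v = tConst c & const_ty c = T.

(* binds_no only makes x and g keep their meaning throughout the body, which can
   be achieved by renaming bound variables. *)
Definition single_pass (T1 T : seq ty) (f : tm) : Prop :=
  exists (T2 : seq ty) (a g x : nat) (body : tm) (init : seq tm),
    let Ts := T1 ++ T2 in
    f = tFun a (tprod TList T1)
          (tLetrec g (TArr (tprod TList Ts) (tprod TList T))
             (tFun x (tprod TList Ts) body)
             (tApp (tVar g) (tm_tuple (tVar a) init)))
    /\ has_type (fun _ => None) f (TArr (tprod TList T1) (tprod TList T))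
    /\ [/\ all is_scalar T1, all is_scalar T
         & all (fun U => is_scalar U || is_list U) T2]
    /\ [/\ x != g, binds_no x body, binds_no g body & source body]
    /\ one_list x (size Ts) body
    /\ no_fun_letrec body
    /\ single_calls x g Ts T (fun _ => [::]) body
    /\ List.Forall2 init_value T2 init.

(** ** The transduction of a single-pass function *)

Fixpoint list_term (w : seq (Sg * D)) : tm :=
  if w is (s, d) :: w' then
    tCons (tPair (tConst (CTag s)) (tConst (CData d))) (list_term w')
  else tNil.

End Language.

(* A convention for encoding scalar values as data-string symbols: at each of the
   three types, distinct values have distinct codes.  It is partial because when
   Sg * D is too small there need not be a total one. *)
Record codec (Sg : finType) (disp : Order.disp_t) (D : orderType disp) := Codec {
  code_of :> const Sg D -> option (Sg * D);
  code_inj : forall c1 c2 a, const_ty c1 = const_ty c2 ->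
    code_of c1 = Some a -> code_of c2 = Some a -> c1 = c2
}.

(* Graph of the partial function [[f]], for f : list * T1 -> list * T. *)
Definition fun_sem (Sg : finType) (disp : Order.disp_t) (D : orderType disp)
    (C : codec Sg D) (T1 T : seq ty) (f : term Sg D) (w w' : seq (Sg * D)) : Prop :=
  exists (ps : seq (const Sg D)) (cp : seq (Sg * D)) (l : seq (Sg * D))
         (rs : seq (const Sg D)) (cr : seq (Sg * D)) (l1 : seq (Sg * D)),
    [/\ map (@const_ty _ _ D) ps = T1, map C ps = map Some cp & w = cp ++ l] /\
    [/\ map (@const_ty _ _ D) rs = T, map C rs = map Some cr & w' = cr ++ l1] /\
    steps (tApp f (tm_tuple (list_term l) (map (@tConst Sg D) ps)))
          (tm_tuple (list_term l1) (map (@tConst Sg D) rs)).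

(** * Effectiveness *)

(* Computability by recursive functions of S-expressions.  The atoms, elements
   of A, are opaque to programs. *)

Inductive sexp (A : Type) : Type :=
| SNil
| SAtom of A
| SCons of sexp A & sexp A.
Arguments SNil {A}.

Inductive prog (A : Type) : Type :=
| PInput
| PQuote of sexp A
| PCar of prog A
| PCdr of prog A
| PCons of prog A & prog A
| PIf of prog A & prog A & prog A      (* the test fails on nil *)
| PComp of prog A & prog A             (* first argument first *)
| PCall of nat.                        (* call of a defined function *)

Inductive runs (A : Type) (defs : seq (prog A)) :
    prog A -> sexp A -> sexp A -> Prop :=
| RunInput e : runs defs (PInput A) e e
| RunQuote c e : runs defs (PQuote c) e c
| RunCar p e e1 e2 : runs defs p e (SCons e1 e2) -> runs defs (PCar p) e e1
| RunCdr p e e1 e2 : runs defs p e (SCons e1 e2) -> runs defs (PCdr p) e e2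
| RunCons p q e e1 e2 :
    runs defs p e e1 -> runs defs q e e2 -> runs defs (PCons p q) e (SCons e1 e2)
| RunIfNil p q r e e1 :
    runs defs p e SNil -> runs defs r e e1 -> runs defs (PIf p q r) e e1
| RunIf p q r e e0 e1 :
    runs defs p e e0 -> e0 <> SNil -> runs defs q e e1 ->
    runs defs (PIf p q r) e e1
| RunComp p q e e1 e2 :
    runs defs p e e1 -> runs defs q e1 e2 -> runs defs (PComp p q) e e2
| RunCall i e e1 :
    i < size defs -> runs defs (nth (PInput A) defs i) e e1 ->
    runs defs (PCall A i) e e1.

Definition computable (A I J : Type) (encI : I -> sexp A) (encJ : J -> sexp A)
    (h : I -> J) : Prop :=
  exists (defs : seq (prog A)) (p : prog A),
    forall i, runs defs p (encI i) (encJ (h i)).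

Section Encoding.
Context {A : Type}.

Fixpoint enc_num (n : nat) : sexp A :=
  if n is m.+1 then SCons SNil (enc_num m) else SNil.
Definition enc_list (es : seq (sexp A)) : sexp A := foldr (@SCons A) SNil es.
Definition enc_option (e : option (sexp A)) : sexp A :=
  if e is Some e' then enc_list [:: e'] else SNil.

(* Elements of a finite set are presented by their rank. *)
Definition enc_fin (T : finType) (x : T) : sexp A := enc_num (enum_rank x).

Fixpoint enc_test (V : finType) (phi : test V) : sexp A :=
  enc_list match phi with
  | Btrue => [:: enc_num 0]
  | Bfalse => [:: enc_num 1]
  | Blt_curr v => [:: enc_num 2; enc_fin v]
  | Bcurr_lt v => [:: enc_num 3; enc_fin v]
  | Bnot p => [:: enc_num 4; enc_test p]
  | Band p q => [:: enc_num 5; enc_test p; enc_test q]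
  | Bor p q => [:: enc_num 6; enc_test p; enc_test q]
  end.

Definition enc_item (Ga V X : finType) (i : item Ga V X) : sexp A :=
  enc_list match i with
  | inl (c, v) => [:: enc_fin c; enc_fin v]
  | inr x => [:: enc_fin x]
  end.

Definition enc_str (Ga V X : finType) (s : seq (item Ga V X)) : sexp A :=
  enc_list (map (@enc_item Ga V X) s).

Definition enc_transition (Sg Ga Q V X : finType) (t : transition Sg Ga Q V X)
    : sexp A :=
  enc_list [:: enc_fin (src t); enc_fin (lab t); enc_test (guard t);
    enc_fin (dst t);
    enc_list [seq enc_fin (asgn_data t v) | v <- enum V];
    enc_list [seq enc_str (asgn_str t x) | x <- enum X]].

Definition enc_sdst (Sg Ga : finType) (S : sdst Sg Ga) : sexp A :=
  enc_list [:: enc_num #|state S|; enc_fin (init_state S);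
    enc_num #|dvar S|; enc_fin (curr S); enc_num #|svar S|;
    enc_list [seq enc_option (omap (@enc_str _ _ _) (out S q)) | q <- enum (state S)];
    enc_list (map (@enc_transition _ _ _ _ _) (trans S))].

Fixpoint enc_ty (T : ty) : sexp A :=
  enc_list match T with
  | TBool => [:: enc_num 0]
  | TTag => [:: enc_num 1]
  | TData => [:: enc_num 2]
  | TList => [:: enc_num 3]
  | TProd T U => [:: enc_num 4; enc_ty T; enc_ty U]
  | TArr T U => [:: enc_num 5; enc_ty T; enc_ty U]
  end.

End Encoding.

(* Constructor of t with its arguments other than subterms. *)
Definition enc_node (Sg : finType) (disp : Order.disp_t) (D : orderType disp)
    (t : term Sg D) : seq (sexp D) :=
  match t with
  | tVar x => [:: enc_num 0; enc_num x]
  | tConst (CBool b) => [:: enc_num 1; enc_num b]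
  | tConst (CTag s) => [:: enc_num 2; enc_fin s]
  | tConst (CData d) => [:: enc_num 3; SAtom d]
  | tIsTrue _ => [:: enc_num 4]
  | tIsFalse _ => [:: enc_num 5]
  | tIsTag s _ => [:: enc_num 6; enc_fin s]
  | tFun x T _ => [:: enc_num 7; enc_num x; enc_ty T]
  | tApp _ _ => [:: enc_num 8]
  | tIf _ _ _ => [:: enc_num 9]
  | tEq _ _ => [:: enc_num 10]
  | tLt _ _ => [:: enc_num 11]
  | tPair _ _ => [:: enc_num 12]
  | tFst _ => [:: enc_num 13]
  | tSnd _ => [:: enc_num 14]
  | tNil => [:: enc_num 15]
  | tCons _ _ => [:: enc_num 16]
  | tAppend _ _ => [:: enc_num 17]
  | tIsNil _ => [:: enc_num 18]
  | tHead _ => [:: enc_num 19]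
  | tTail _ => [:: enc_num 20]
  | tLet x _ _ => [:: enc_num 21; enc_num x]
  | tLetrec x T _ _ => [:: enc_num 22; enc_num x; enc_ty T]
  end.

Definition enc_term (Sg : finType) (disp : Order.disp_t) (D : orderType disp)
    : term Sg D -> sexp D :=
  fold_term (fun t es => enc_list (enc_node t ++ es)).

(* Main.v *)
Require Import Defs.
From mathcomp Require Import all_boot all_order.
From mathcomp Require Import zify.
From Stdlib Require List Relation_Operators Classical_Prop.

Set Implicit Arguments.
Unset Strict Implicit.
Unset Printing Implicit Defensive.

(* The compiled function keeps the configuration of the transducer in its extra
   arguments: one boolean per state (the current state is the one whose flag is
   true), and for each data or string variable a boolean telling whether it is
   defined together with a value, arbitrary if it is not.  On a nonempty list
   it tests the transitions one after the other and calls itself on the tail with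
   the updated configuration; since assignments are copyless, no list argument is
   duplicated.  When no transition is enabled it goes on with no current state.
   On the empty list it returns the output of the current state, and gets stuck on
   head nil if there is none.  The head of the list is let-bound, as each argument
   of the recursive call mentioning curr would otherwise count as a use of the
   list.  If D is empty there is no initial value for the data variables, but then
   the only input is the empty string.  Evaluation is deterministic, so it is
   enough to exhibit, for every input, one evaluation to a value or to a stuck
   term. *)

(** * Computable functions on codes *)

(** Under the one-list discipline a well-typed body can get stuck only in [head] or [tail] of the
    empty input list. A blocked run therefore cannot be reported where it blocks, and has to be
    carried along to the end of the input. Definedness travels apart from the values because the
    language has no undefined value to pass around, while an undefined variable matters only to the
    tests and strings in which it occurs; each of these is guarded by a boolean term that computes
    its definedness.

    For effectiveness, the code of a transducer mentions states and variables only through their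
    ranks. The translation thus factors through a presentation by ranks that has the same code, and
    all programs are built for that presentation. No program is written out as a whole:
    computability from a coded environment is closed under constructors, composition and structural
    recursion, so it suffices to follow the definition of the compiled term. Whether an initial
    datum exists is settled before the translation is chosen; the datum is a fixed parameter of
    it. *)

Section Computability.
Context {A : Type}.
Implicit Types (p : prog A) (d : seq (prog A)).

Fixpoint shift (k : nat) p : prog A :=
  match p with
  | PInput => PInput A
  | PQuote c => PQuote c
  | PCar q => PCar (shift k q)
  | PCdr q => PCdr (shift k q)
  | PCons q r => PCons (shift k q) (shift k r)
  | PIf q r s => PIf (shift k q) (shift k r) (shift k s)
  | PComp q r => PComp (shift k q) (shift k r)
  | PCall i => PCall A (k + i)
  end.

(** Calls go by position, so placing definitions in front of a list means renumbering its calls.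
    Together with [runs_weaken], which appends behind, this lets two lists of definitions be merged
    into one. *)
Lemma runs_shift pre d p e v :
  runs d p e v ->
  runs (pre ++ map (shift (size pre)) d) (shift (size pre) p) e v.
Proof.
elim=> {p e v} /=; try by econstructor; eauto.
move=> i e e1 lti _ IH; apply: RunCall; first by rewrite size_cat size_map ltn_add2l.
by rewrite nth_cat ltnNge leq_addr addKn (nth_map (PInput A)).
Qed.

Lemma runs_weaken post d p e v : runs d p e v -> runs (d ++ post) p e v.
Proof.
elim=> {p e v} /=; try by econstructor; eauto.
move=> i e e1 lti _ IH; apply: RunCall; last by rewrite nth_cat lti.
by rewrite size_cat ltn_addr.
Qed.

Definition cmp_on d (I : Type) (E G : I -> sexp A) : Prop :=
  exists p, forall i, runs d p (E i) (G i).

(* The index i plays the role of an environment: its code is E i, and G i is the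
   code of the result computed from it. *)
Definition cmp (I : Type) (E G : I -> sexp A) : Prop := exists d, cmp_on d E G.

(** The transfer is quantified over index types and codes because a single join has to serve
    premises about different environments, such as a base case and a recursion step with extra
    data. *)
Lemma cmp_on_join d1 d2 : exists d,
  (forall I (E G : I -> sexp A), cmp_on d1 E G -> cmp_on d E G) /\
  (forall I (E G : I -> sexp A), cmp_on d2 E G -> cmp_on d E G).
Proof.
exists (d1 ++ map (shift (size d1)) d2); split=> I E G [p Hp].
  by exists p => i; apply: runs_weaken.
by exists (shift (size d1) p) => i; apply: runs_shift.
Qed.

Lemma cmp_input I (E : I -> sexp A) : cmp E E.
Proof. by exists [::], (PInput A) => i; constructor. Qed.

Lemma cmp_const I (E : I -> sexp A) c : cmp E (fun _ => c).
Proof. by exists [::], (PQuote c) => i; constructor. Qed.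

Lemma cmp_sub I J (u : J -> I) (E G : I -> sexp A) :
  cmp E G -> cmp (fun j => E (u j)) (fun j => G (u j)).
Proof. by move=> [d [p Hp]]; exists d, p. Qed.

Lemma cmp_comp I (E F G : I -> sexp A) : cmp E F -> cmp F G -> cmp E G.
Proof.
move=> [d1 H1] [d2 H2]; have [d [J1 J2]] := cmp_on_join d1 d2.
have [p Hp] := J1 _ _ _ H1; have [q Hq] := J2 _ _ _ H2.
by exists d, (PComp p q) => i; econstructor; eauto.
Qed.

Lemma cmp_cons I (E F G : I -> sexp A) :
  cmp E F -> cmp E G -> cmp E (fun i => SCons (F i) (G i)).
Proof.
move=> [d1 H1] [d2 H2]; have [d [J1 J2]] := cmp_on_join d1 d2.
have [p Hp] := J1 _ _ _ H1; have [q Hq] := J2 _ _ _ H2.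
by exists d, (PCons p q) => i; econstructor; eauto.
Qed.

Lemma cmp_car I (E F G : I -> sexp A) :
  cmp E (fun i => SCons (F i) (G i)) -> cmp E F.
Proof. by move=> [d [p Hp]]; exists d, (PCar p) => i; econstructor; eauto. Qed.

Lemma cmp_cdr I (E F G : I -> sexp A) :
  cmp E (fun i => SCons (F i) (G i)) -> cmp E G.
Proof. by move=> [d [p Hp]]; exists d, (PCdr p) => i; econstructor; eauto. Qed.

Lemma cmp_fst I J (E G : I -> sexp A) (F : I * J -> sexp A) :
  cmp E G -> cmp (fun z => SCons (E z.1) (F z)) (fun z => G z.1).
Proof.
move=> /(cmp_sub (@fst I J)); apply: cmp_comp.
exact: cmp_car (cmp_input _).
Qed.

Lemma cmp_snd I J (E : I * J -> sexp A) (F : J -> sexp A) :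
  cmp (fun z => SCons (E z) (F z.2)) (fun z => F z.2).
Proof. exact: cmp_cdr (cmp_input _). Qed.

Lemma cmp_pif I (E F G H : I -> sexp A) (b : I -> bool) :
  cmp E F -> (forall i, F i = SNil <-> b i = false) -> cmp E G -> cmp E H ->
  cmp E (fun i => if b i then G i else H i).
Proof.
move=> [d1 H1] Fb [d2 H2] [d3 H3].
have [d4 [J1 J2]] := cmp_on_join d1 d2; have [d [J3 J4]] := cmp_on_join d4 d3.
have [p Hp] := J3 _ _ _ (J1 _ _ _ H1); have [q Hq] := J3 _ _ _ (J2 _ _ _ H2).
have [r Hr] := J4 _ _ _ H3; exists d, (PIf p q r) => i.
case Eb: (b i); last by apply: RunIfNil => //; have/Fb <- := Eb.
by apply: RunIf (Hp i) _ _ => // /Fb; rewrite Eb.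
Qed.

(* As cmp_pif, but each branch only has to work on its own side. *)
Lemma cmp_case I (E F G : I -> sexp A) (I1 I2 : Type)
    (u1 : I1 -> I) (u2 : I2 -> I) :
  cmp E F ->
  (forall i, F i = SNil /\ (exists j, i = u2 j) \/ F i <> SNil /\ (exists j, i = u1 j)) ->
  cmp (fun j => E (u1 j)) (fun j => G (u1 j)) ->
  cmp (fun j => E (u2 j)) (fun j => G (u2 j)) -> cmp E G.
Proof.
move=> [d1 H1] Fb [d2 H2] [d3 H3].
have [d4 [J1 J2]] := cmp_on_join d1 d2; have [d [J3 J4]] := cmp_on_join d4 d3.
have [p Hp] := J3 _ _ _ (J1 _ _ _ H1); have [q Hq] := J3 _ _ _ (J2 _ _ _ H2).
have [r Hr] := J4 _ _ _ H3; exists d, (PIf p q r) => i.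
case: (Fb i) => -[Fi [j Ej]]; last by apply: RunIf (Hp i) _ _; rewrite // Ej.
by apply: RunIfNil; rewrite -?Fi // Ej.
Qed.

Definition enc_seq (X : Type) (enc : X -> sexp A) (s : seq X) : sexp A :=
  enc_list (map enc s).

(** The loop is added as definition 0, which moves all earlier definitions up by one. Each round
    hands the environment, the head and the value on the tail to the step program; the tail itself
    is not passed on. *)
Lemma cmp_seq_rec I X (E : I -> sexp A) (enc : X -> sexp A)
    (f : I -> seq X -> sexp A) :
  cmp E (fun i => f i [::]) ->
  cmp (fun z : I * X * seq X =>
         SCons (SCons (E z.1.1) (enc z.1.2)) (f z.1.1 z.2))
      (fun z => f z.1.1 (z.1.2 :: z.2)) ->
  cmp (fun z : I * seq X => SCons (E z.1) (enc_seq enc z.2))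
      (fun z => f z.1 z.2).
Proof.
move=> [d1 H1] [d2 H2]; have [d [J1 J2]] := cmp_on_join d1 d2.
have [p1 Hp1] := J1 _ _ _ H1; have [p2 Hp2] := J2 _ _ _ H2.
pose i0 := PCar (PInput A); pose s0 := PCdr (PInput A).
pose r := PIf s0
  (PComp (PCons (PCons i0 (PCar s0)) (PComp (PCons i0 (PCdr s0)) (PCall A 0)))
         (shift 1 p2))
  (PComp i0 (shift 1 p1)).
exists (r :: map (shift 1) d), (PCall A 0) => -[i s] /=.
elim: s => [|x s IH]; apply: RunCall => //=.
  apply: RunIfNil; first by repeat econstructor.
  apply: RunComp; first by repeat econstructor.
  exact: (@runs_shift [:: r]).
apply: RunIf; first by repeat econstructor.
  by [].
apply: (RunComp _ ((@runs_shift [:: r]) _ _ _ _ (Hp2 (i, x, s)))) => /=.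
apply: RunCons; first by repeat econstructor.
by apply: RunComp IH; repeat econstructor.
Qed.

(** Here [enc_t] is known only through its unfolding equation. The variable cases receive the coded
    variable, the compound cases the values already computed on the subtests. *)
Lemma cmp_test_rec I (E : I -> sexp A) (enc : nat -> sexp A)
    (enc_t : test nat -> sexp A) (f : I -> test nat -> sexp A) :
  (forall t, enc_t t = enc_list match t with
    | Btrue => [:: enc_num 0]
    | Bfalse => [:: enc_num 1]
    | Blt_curr v => [:: enc_num 2; enc v]
    | Bcurr_lt v => [:: enc_num 3; enc v]
    | Bnot p => [:: enc_num 4; enc_t p]
    | Band p q => [:: enc_num 5; enc_t p; enc_t q]
    | Bor p q => [:: enc_num 6; enc_t p; enc_t q]
    end) ->
  cmp E (fun i => f i (Btrue _)) ->
  cmp E (fun i => f i (Bfalse _)) ->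
  cmp (fun z : I * nat => SCons (E z.1) (enc z.2)) (fun z => f z.1 (Blt_curr z.2)) ->
  cmp (fun z : I * nat => SCons (E z.1) (enc z.2)) (fun z => f z.1 (Bcurr_lt z.2)) ->
  cmp (fun z : I * test nat => SCons (E z.1) (f z.1 z.2))
      (fun z => f z.1 (Bnot z.2)) ->
  cmp (fun z : I * test nat * test nat =>
         SCons (SCons (E z.1.1) (f z.1.1 z.1.2)) (f z.1.1 z.2))
      (fun z => f z.1.1 (Band z.1.2 z.2)) ->
  cmp (fun z : I * test nat * test nat =>
         SCons (SCons (E z.1.1) (f z.1.1 z.1.2)) (f z.1.1 z.2))
      (fun z => f z.1.1 (Bor z.1.2 z.2)) ->
  cmp (fun z : I * test nat => SCons (E z.1) (enc_t z.2)) (fun z => f z.1 z.2).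
Proof.
move=> Et [d0 H0] [d1 H1] [d2 H2] [d3 H3] [d4 H4] [d5 H5] [d6 H6].
have [d01 [J0 J1]] := cmp_on_join d0 d1.
have [d12 [J01 J2]] := cmp_on_join d01 d2.
have [d23 [J12 J3]] := cmp_on_join d12 d3.
have [d34 [J23 J4]] := cmp_on_join d23 d4.
have [d45 [J34 J5]] := cmp_on_join d34 d5.
have [d [J45 J6]] := cmp_on_join d45 d6.
have [p0 {H0} H0] := J45 _ _ _ (J34 _ _ _ (J23 _ _ _ (J12 _ _ _ (J01 _ _ _ (J0 _ _ _ H0))))).
have [p1 {H1} H1] := J45 _ _ _ (J34 _ _ _ (J23 _ _ _ (J12 _ _ _ (J01 _ _ _ (J1 _ _ _ H1))))).
have [p2 {H2} H2] := J45 _ _ _ (J34 _ _ _ (J23 _ _ _ (J12 _ _ _ (J2 _ _ _ H2)))).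
have [p3 {H3} H3] := J45 _ _ _ (J34 _ _ _ (J23 _ _ _ (J3 _ _ _ H3))).
have [p4 {H4} H4] := J45 _ _ _ (J34 _ _ _ (J4 _ _ _ H4)).
have [p5 {H5} H5] := J45 _ _ _ (J5 _ _ _ H5).
have [p6 {H6} H6] := J6 _ _ _ H6.
pose i0 := PCar (PInput A); pose t0 := PCdr (PInput A).
pose tag := PCar t0; pose a1 := PCar (PCdr t0); pose a2 := PCar (PCdr (PCdr t0)).
pose rec a := PComp (PCons i0 a) (PCall A 0).
pose r2 := PCons (PCons i0 (rec a1)) (rec a2).
(* Tags are unary, so each further [PCdr] of the tag excludes one more constructor; the leaves come
   in the order of the tags 6 down to 0. *)
pose r := PIf tag (PIf (PCdr tag) (PIf (PCdr (PCdr tag))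
  (PIf (PCdr (PCdr (PCdr tag))) (PIf (PCdr (PCdr (PCdr (PCdr tag))))
    (PIf (PCdr (PCdr (PCdr (PCdr (PCdr tag)))))
       (PComp r2 (shift 1 p6)) (PComp r2 (shift 1 p5)))
    (PComp (PCons i0 (rec a1)) (shift 1 p4)))
  (PComp (PCons i0 a1) (shift 1 p3))) (PComp (PCons i0 a1) (shift 1 p2)))
  (PComp i0 (shift 1 p1))) (PComp i0 (shift 1 p0)).
have S1 p e v : runs d p e v -> runs (r :: map (shift 1) d) (shift 1 p) e v.
  exact: (@runs_shift [:: r]).
exists (r :: map (shift 1) d), (PCall A 0) => -[i t] /=.
elim: t => [||v|v|p IHp|p IHp q IHq|p IHp q IHq]; apply: RunCall => //=; rewrite Et /=.
- apply: RunIfNil; first by repeat econstructor.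
  by apply: (RunComp _ (S1 _ _ _ (H0 i))); repeat econstructor.
- apply: RunIf; first by repeat econstructor.
    by [].
  apply: RunIfNil; first by repeat econstructor.
  by apply: (RunComp _ (S1 _ _ _ (H1 i))); repeat econstructor.
- do 2 (apply: RunIf; [by repeat econstructor | by [] |]).
  apply: RunIfNil; first by repeat econstructor.
  by apply: (RunComp _ (S1 _ _ _ (H2 (i, v)))); repeat econstructor.
- do 3 (apply: RunIf; [by repeat econstructor | by [] |]).
  apply: RunIfNil; first by repeat econstructor.
  by apply: (RunComp _ (S1 _ _ _ (H3 (i, v)))); repeat econstructor.
- do 4 (apply: RunIf; [by repeat econstructor | by [] |]).
  apply: RunIfNil; first by repeat econstructor.
  apply: (RunComp _ (S1 _ _ _ (H4 (i, p)))) => /=.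
  apply: RunCons; first by repeat econstructor.
  by apply: RunComp IHp; repeat econstructor.
- do 5 (apply: RunIf; [by repeat econstructor | by [] |]).
  apply: RunIfNil; first by repeat econstructor.
  apply: (RunComp _ (S1 _ _ _ (H5 (i, p, q)))) => /=.
  apply: RunCons; first apply: RunCons; first by repeat econstructor.
    by apply: RunComp IHp; repeat econstructor.
  by apply: RunComp IHq; repeat econstructor.
- do 6 (apply: RunIf; [by repeat econstructor | by [] |]).
  apply: (RunComp _ (S1 _ _ _ (H6 (i, p, q)))) => /=.
  apply: RunCons; first apply: RunCons; first by repeat econstructor.
    by apply: RunComp IHp; repeat econstructor.
  by apply: RunComp IHq; repeat econstructor.
Qed.

End Computability.

(** * List and number operations on codes *)

Section Combinators.
Context {A I : Type} (E : I -> sexp A).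

Lemma cmp_foldr X Y (encX : X -> sexp A) (encY : Y -> sexp A)
    (f : I -> X -> Y -> Y) (y : I -> Y) (s : I -> seq X) :
  cmp E (fun i => enc_seq encX (s i)) ->
  cmp E (fun i => encY (y i)) ->
  cmp (fun z : I * X * Y => SCons (SCons (E z.1.1) (encX z.1.2)) (encY z.2))
      (fun z => encY (f z.1.1 z.1.2 z.2)) ->
  cmp E (fun i => encY (foldr (f i) (y i) (s i))).
Proof.
move=> Hs Hy Hf.
have R := @cmp_seq_rec A I X E encX (fun i s => encY (foldr (f i) (y i) s)) Hy
  (cmp_sub (fun z : I * X * seq X => (z.1, foldr (f z.1.1) (y z.1.1) z.2)) Hf).
exact: (cmp_comp (cmp_cons (cmp_input E) Hs) (cmp_sub (fun i => (i, s i)) R)).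
Qed.

Lemma cmp_seq_cons X (encX : X -> sexp A) (x : I -> X) (s : I -> seq X) :
  cmp E (fun i => encX (x i)) -> cmp E (fun i => enc_seq encX (s i)) ->
  cmp E (fun i => enc_seq encX (x i :: s i)).
Proof. exact: cmp_cons. Qed.

Lemma cmp_map X Y (encX : X -> sexp A) (encY : Y -> sexp A)
    (f : I -> X -> Y) (s : I -> seq X) :
  cmp E (fun i => enc_seq encX (s i)) ->
  cmp (fun z : I * X => SCons (E z.1) (encX z.2)) (fun z => encY (f z.1 z.2)) ->
  cmp E (fun i => enc_seq encY (map (f i) (s i))).
Proof.
move=> Hs Hf.
apply: (@cmp_foldr X (seq Y) encX (enc_seq encY) (fun i x t => f i x :: t)
          (fun _ => [::]) s) => //; first exact: cmp_const.
apply: cmp_cons; last exact: (cmp_snd _ (enc_seq encY)).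
exact: (cmp_fst _ Hf).
Qed.

Lemma cmp_cat X (encX : X -> sexp A) (s t : I -> seq X) :
  cmp E (fun i => enc_seq encX (s i)) -> cmp E (fun i => enc_seq encX (t i)) ->
  cmp E (fun i => enc_seq encX (s i ++ t i)).
Proof.
move=> Hs Ht.
suff: cmp E (fun i => enc_seq encX (foldr cons (t i) (s i))).
  move=> [d [p Hp]]; exists d, p => i; move: (Hp i).
  by congr (runs _ _ _ (enc_seq _ _)); elim: (s i) => //= x r ->.
apply: (@cmp_foldr X (seq X) encX (enc_seq encX) (fun _ => cons) t s Hs Ht).
apply: cmp_cons; last exact: (cmp_snd _ (enc_seq encX)).
exact: (@cmp_fst A (I * X) (seq X) _ _ _ (cmp_snd (fun z => E z.1) encX)).
Qed.

(** A unary number has the same code as a list of that many units, so iteration is a fold over such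
    a list. *)
Lemma cmp_iter Y (encY : Y -> sexp A) (f : I -> Y -> Y) (n : I -> nat) (y : I -> Y) :
  cmp E (fun i => enc_num (n i)) -> cmp E (fun i => encY (y i)) ->
  cmp (fun z : I * Y => SCons (E z.1) (encY z.2)) (fun z => encY (f z.1 z.2)) ->
  cmp E (fun i => encY (iter (n i) (f i) (y i))).
Proof.
move=> Hn Hy Hf.
suff: cmp E (fun i => encY (foldr (fun _ => f i) (y i) (nseq (n i) tt))).
  move=> [d [p Hp]]; exists d, p => i; move: (Hp i).
  by congr (runs _ _ _ (encY _)); elim: (n i) => //= m ->.
apply: (@cmp_foldr unit Y (fun _ => SNil) encY (fun i _ => f i)) => //.
  move: Hn => [d [p Hp]]; exists d, p => i; move: (Hp i).
  by congr (runs _ _ _ _); rewrite /enc_seq; elim: (n i) => //= m ->.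
pose u (z : I * unit * Y) := (z.1.1, z.2).
apply: cmp_comp (cmp_sub u Hf); apply: cmp_cons; last exact: cmp_snd.
exact: (cmp_fst (E := fun z : I * unit => SCons (E z.1) SNil) _
         (cmp_fst _ (cmp_input E))).
Qed.

(** [PCdr] has no value on nil, so the empty list is tested for before it is applied. The same guard
    serves [cmp_pred] and [cmp_nth]. *)
Lemma cmp_behead X (encX : X -> sexp A) (s : I -> seq X) :
  cmp E (fun i => enc_seq encX (s i)) -> cmp E (fun i => enc_seq encX (behead (s i))).
Proof.
move=> [d [p Hp]]; exists d, (PIf p (PCdr p) (PQuote SNil)) => i.
move: (Hp i); case: (s i) => [|x r] /= R.
  by apply: RunIfNil => //; constructor.
by apply: RunIf (R) _ _ => //; apply: RunCdr R.
Qed.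

Lemma cmp_ifb Y (encY : Y -> sexp A) (b : I -> bool) (x y : I -> Y) :
  cmp E (fun i => enc_num (b i)) -> cmp E (fun i => encY (x i)) ->
  cmp E (fun i => encY (y i)) -> cmp E (fun i => encY (if b i then x i else y i)).
Proof.
move=> Hb Hx Hy; have He i : enc_num (b i) = @SNil A <-> b i = false by case: (b i).
have [d [p Hp]] := cmp_pif Hb He Hx Hy.
by exists d, p => i; move: (Hp i); case: (b i).
Qed.

Lemma cmp_ext (F G : I -> sexp A) : F =1 G -> cmp E F -> cmp E G.
Proof. move=> eFG [d [p Hp]]; exists d, p => i; rewrite -eFG. exact: Hp. Qed.

Lemma cmp_S (n : I -> nat) :
  cmp E (fun i => enc_num (n i)) -> cmp E (fun i => enc_num (n i).+1).
Proof. by apply: cmp_cons; apply: cmp_const. Qed.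

Lemma cmp_pred (n : I -> nat) :
  cmp E (fun i => enc_num (n i)) -> cmp E (fun i => enc_num (n i).-1).
Proof.
move=> [d [p Hp]]; exists d, (PIf p (PCdr p) (PQuote SNil)) => i.
move: (Hp i); case: (n i) => [|m] /= R.
  by apply: RunIfNil => //; constructor.
by apply: RunIf (R) _ _ => //; apply: RunCdr R.
Qed.

End Combinators.

Section Arithmetic.
Context {A I : Type} (E : I -> sexp A).

Lemma cmp_drop X (encX : X -> sexp A) (n : I -> nat) (s : I -> seq X) :
  cmp E (fun i => enc_num (n i)) -> cmp E (fun i => enc_seq encX (s i)) ->
  cmp E (fun i => enc_seq encX (drop (n i) (s i))).
Proof.
move=> Hn Hs; apply: (cmp_ext (fun i => congr1 _ (esym (drop_behead (n i) (s i))))).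
apply: (cmp_iter (f := fun _ => behead) (encY := enc_seq encX)) => //=.
by apply: cmp_behead; exact: cmp_snd.
Qed.

Lemma cmp_nth X (encX : X -> sexp A) (x0 : X) (n : I -> nat) (s : I -> seq X) :
  cmp E (fun i => enc_num (n i)) -> cmp E (fun i => enc_seq encX (s i)) ->
  cmp E (fun i => encX (nth x0 (s i) (n i))).
Proof.
move=> Hn Hs; have [d [p Hp]] := cmp_drop Hn Hs.
exists d, (PIf p (PCar p) (PQuote (encX x0))) => i.
rewrite -[n i]addn0 -nth_drop; move: (Hp i); case: (drop _ _) => [|x r] /= R.
  by apply: RunIfNil => //; constructor.
by apply: RunIf (R) _ _ => //; apply: RunCar R.
Qed.

Lemma cmp_add (m n : I -> nat) :
  cmp E (fun i => enc_num (m i)) -> cmp E (fun i => enc_num (n i)) ->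
  cmp E (fun i => enc_num (m i + n i)).
Proof.
move=> Hm Hn; apply: (cmp_ext (fun i => congr1 _ (iter_succn (m i) (n i)))).
apply: (cmp_iter (f := fun _ => succn) (encY := enc_num)) => //=.
by apply: cmp_S; exact: cmp_snd.
Qed.

Lemma cmp_subn (m n : I -> nat) :
  cmp E (fun i => enc_num (m i)) -> cmp E (fun i => enc_num (n i)) ->
  cmp E (fun i => enc_num (m i - n i)).
Proof.
move=> Hm Hn; apply: (cmp_ext (fun i => congr1 _ (iter_predn (m i) (n i)))).
apply: (cmp_iter (f := fun _ => predn) (encY := enc_num)) => //=.
by apply: cmp_pred; exact: cmp_snd.
Qed.

(** Truncated subtraction in both directions: the sum of the two differences is 0, whose code is
    nil, exactly when the numbers agree. *)
Lemma cmp_eqn (m n : I -> nat) :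
  cmp E (fun i => enc_num (m i)) -> cmp E (fun i => enc_num (n i)) ->
  cmp E (fun i => enc_num (m i == n i)).
Proof.
move=> Hm Hn.
have He i : enc_num (m i - n i + (n i - m i)) = @SNil A <-> (m i != n i) = false.
  rewrite eqn_leq -!subn_eq0 -addn_eq0.
  by case: (_ + _); split.
have := cmp_pif (cmp_add (cmp_subn Hm Hn) (cmp_subn Hn Hm)) He
          (cmp_const E (enc_num 0)) (cmp_const E (enc_num 1)).
by apply: cmp_ext => i; case: eqP.
Qed.

Lemma cmp_iota (n : I -> nat) :
  cmp E (fun i => enc_num (n i)) -> cmp E (fun i => enc_seq enc_num (iota 0 (n i))).
Proof.
move=> Hn; pose f (_ : I) s := 0 :: map succn s.
have ef i : enc_seq (A := A) enc_num (iter (n i) (f i) [::]) = enc_seq enc_num (iota 0 (n i)).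
  by congr enc_seq; elim: (n i) => //= k ->; rewrite /f -(iotaDl 1 0).
apply: (cmp_ext ef); apply: (cmp_iter (f := f) (encY := enc_seq enc_num)) => //.
  exact: cmp_const.
apply: cmp_seq_cons; first exact: cmp_const.
apply: (cmp_map (f := fun _ => succn) (encX := enc_num)); first exact: cmp_snd.
by apply: cmp_S; exact: cmp_snd.
Qed.

Lemma cmp_nseq X (encX : X -> sexp A) (n : I -> nat) (x : I -> X) :
  cmp E (fun i => enc_num (n i)) -> cmp E (fun i => encX (x i)) ->
  cmp E (fun i => enc_seq encX (nseq (n i) (x i))).
Proof.
move=> Hn Hx.
apply: (cmp_iter (f := fun i => cons (x i)) (encY := enc_seq encX)) => //.
  exact: cmp_const.
by apply: cmp_seq_cons; [exact: (cmp_fst _ Hx) | exact: cmp_snd].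
Qed.

Lemma cmp_rev X (encX : X -> sexp A) (s : I -> seq X) :
  cmp E (fun i => enc_seq encX (s i)) -> cmp E (fun i => enc_seq encX (rev (s i))).
Proof.
move=> Hs; pose f (_ : I) x (t : seq X) := t ++ [:: x].
have ef i : enc_seq encX (foldr (f i) [::] (s i)) = enc_seq encX (rev (s i)).
  by congr enc_seq; elim: (s i) => //= x r ->; rewrite /f rev_cons cats1.
apply: (cmp_ext ef); apply: (cmp_foldr (f := f) Hs); first exact: cmp_const.
rewrite /f /=; apply: cmp_cat; first exact: (cmp_snd _ (enc_seq encX)).
apply: cmp_seq_cons; last exact: cmp_const.
exact: (@cmp_fst A (I * X) (seq X) _ _ _ (cmp_snd (fun z => E z.1) encX)).
Qed.

Lemma cmp_foldl X Y (encX : X -> sexp A) (encY : Y -> sexp A)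
    (f : I -> Y -> X -> Y) (y : I -> Y) (s : I -> seq X) :
  cmp E (fun i => enc_seq encX (s i)) ->
  cmp E (fun i => encY (y i)) ->
  cmp (fun z : I * X * Y => SCons (SCons (E z.1.1) (encX z.1.2)) (encY z.2))
      (fun z => encY (f z.1.1 z.2 z.1.2)) ->
  cmp E (fun i => encY (foldl (f i) (y i) (s i))).
Proof.
move=> Hs Hy Hf.
have ef i : encY (foldr (fun x t => f i t x) (y i) (rev (s i))) =
    encY (foldl (f i) (y i) (s i)).
  by rewrite -foldl_rev revK.
by apply: (cmp_ext ef); apply: (cmp_foldr (cmp_rev Hs) Hy Hf).
Qed.

End Arithmetic.

(** * The compiled function *)

(* Transducers with states and variables replaced by their ranks. *)
Record raw_transition (Sg : finType) := RawTransition {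
  raw_src : nat;
  raw_lab : Sg;
  raw_guard : test nat;
  raw_dst : nat;
  raw_data : seq nat;
  raw_str : seq (seq (item Sg nat nat))
}.

Record raw_sdst (Sg : finType) := RawSdst {
  raw_nq : nat;
  raw_init : nat;
  raw_nv : nat;
  raw_curr : nat;
  raw_nx : nat;
  raw_out : seq (option (seq (item Sg nat nat)));
  raw_trans : seq (raw_transition Sg)
}.

Fixpoint map_test (V W : Type) (f : V -> W) (phi : test V) : test W :=
  match phi with
  | Btrue => Btrue W
  | Bfalse => Bfalse W
  | Blt_curr v => Blt_curr (f v)
  | Bcurr_lt v => Bcurr_lt (f v)
  | Bnot p => Bnot (map_test f p)
  | Band p q => Band (map_test f p) (map_test f q)
  | Bor p q => Bor (map_test f p) (map_test f q)
  end.

(* A constant hides the several ways in which #|T| elaborates. *)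
Definition card_of (T : finType) : nat := #|T|.

Definition rank (T : finType) (x : T) : nat := enum_rank x.

Definition raw_item (Sg V X : finType) (i : item Sg V X) : item Sg nat nat :=
  match i with inl cv => inl (cv.1, rank cv.2) | inr x => inr (rank x) end.

Definition raw_of_transition (Sg Q V X : finType) (t : transition Sg Sg Q V X) :=
  RawTransition (rank (src t)) (lab t) (map_test (@rank V) (guard t)) (rank (dst t))
    [seq rank (asgn_data t v) | v <- enum V]
    [seq map (@raw_item Sg V X) (asgn_str t x) | x <- enum X].

Definition raw_of (Sg : finType) (S : sdst Sg Sg) : raw_sdst Sg :=
  RawSdst (card_of (state S)) (rank (init_state S)) (card_of (dvar S))
    (rank (curr S)) (card_of (svar S))
    [seq omap (map (@raw_item _ _ _)) (out S q) | q <- enum (state S)]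
    (map (@raw_of_transition _ _ _ _) (trans S)).

Section Compile.
Context {Sg : finType} {disp : Order.disp_t} {D : orderType disp}.
Notation tm := (term Sg D).
Notation tbool b := (@tConst Sg D (CBool b)).

(* Terms giving, for a data or string variable, whether it is defined and its
   value (junk when it is undefined). *)
Record access := Access {
  data_def : nat -> tm;
  data_val : nat -> tm;
  str_def : nat -> tm;
  str_val : nat -> tm
}.

Definition tand (t u : tm) : tm := tIf t u (tbool false).

Definition item_def (A : access) (i : item Sg nat nat) : tm :=
  match i with inl cv => data_def A cv.2 | inr x => str_def A x end.

Definition item_val (A : access) (i : item Sg nat nat) (t : tm) : tm :=
  match i with
  | inl cv => tCons (tPair (tConst (CTag cv.1)) (data_val A cv.2)) t
  | inr x => tAppend (str_val A x) t
  end.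

Definition items_def (A : access) (s : seq (item Sg nat nat)) : tm :=
  foldr (fun i => tand (item_def A i)) (tbool true) s.

Definition items_val (A : access) (s : seq (item Sg nat nat)) : tm :=
  foldr (item_val A) tNil s.

(** The definedness of [curr], which every atom mentions, is left out: guards are evaluated after
    [curr] has received the data value of the head. *)
Fixpoint test_def (A : access) (phi : test nat) : tm :=
  match phi with
  | Btrue | Bfalse => tbool true
  | Blt_curr v | Bcurr_lt v => data_def A v
  | Bnot p => test_def A p
  | Band p q | Bor p q => tand (test_def A p) (test_def A q)
  end.

Fixpoint test_val (A : access) (c : tm) (phi : test nat) : tm :=
  match phi with
  | Btrue => tbool true
  | Bfalse => tbool false
  | Blt_curr v => tLt (data_val A v) c
  | Bcurr_lt v => tLt c (data_val A v)
  | Bnot p => tIsFalse (test_val A c p)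
  | Band p q => tand (test_val A c p) (test_val A c q)
  | Bor p q => tIf (test_val A c p) (tbool true) (test_val A c q)
  end.

(* Well typed, but stuck when the list l is empty. *)
Definition fail (l : tm) : tm := tCons (tHead l) tNil.

Definition out_term (A : access) (l : tm) (o : option (seq (item Sg nat nat))) : tm :=
  if o is Some s then tIf (items_def A s) (items_val A s) (fail l) else fail l.

(* Names: 0 is the argument, 1 the recursive function, 2 the result of the
   recursive call and 3 the head of the input list. *)
Definition lref (n : nat) : tm := iter n (@tFst Sg D) (tVar 0).
(** Arguments are counted from 0 after the list, which is itself component 0 of the tuple: argument
    [k] is component [k.+1]. *)
Definition component (n k : nat) : tm := tSnd (iter (n - k.+1) (@tFst Sg D) (tVar 0)).

Section Body.
Variable R : raw_sdst Sg.
Let nq := raw_nq R.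
Let nv := raw_nv R.
Let nx := raw_nx R.

(** Blocks in order: flags of the states, definedness and then values of the data variables,
    definedness and then values of the string variables. With the strings last, the list arguments
    are those past all scalar ones. *)
Definition arg_types : seq ty :=
  nseq nq TBool ++ nseq nv TBool ++ nseq nv TData ++ nseq nx TBool ++ nseq nx TList.

Definition nargs : nat := nq + (nv + (nv + (nx + nx))).

Definition access0 : access :=
  Access (fun v => component nargs (nq + v)) (fun v => component nargs (nq + (nv + v)))
    (fun x => component nargs (nq + (nv + (nv + x))))
    (fun x => component nargs (nq + (nv + (nv + (nx + x))))).

(* After curr has been set to the data value of the head. *)
Definition access1 : access :=
  Access (fun v => if v == raw_curr R then tbool true else data_def access0 v)
    (fun v => if v == raw_curr R then tSnd (tVar 3) else data_val access0 v)
    (str_def access0) (str_val access0).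

(** The compiled function returns no scalars, so the result tuple is just a list and is returned
    unchanged. The let is there because a recursive call must have this form. *)
Definition call (args : seq tm) : tm :=
  tLet 2 (tApp (tVar 1) (tm_tuple (tTail (lref nargs)) args)) (tVar 2).

(* All flags are false when k is not the rank of a state. *)
Definition state_flags (k : nat) : seq tm := [seq tbool (q == k) | q <- iota 0 nq].

Definition trans_args (t : raw_transition Sg) : seq tm :=
  state_flags (raw_dst t) ++ map (data_def access1) (raw_data t)
    ++ map (data_val access1) (raw_data t)
    ++ map (items_def access1) (raw_str t) ++ map (items_val access1) (raw_str t).

(** The number [nq] is not a rank, so no state flag is set. The data arguments need some inhabitant,
    and the data value of the head is at hand. *)
Definition dead_args : seq tm :=
  state_flags nq ++ nseq nv (tbool false) ++ nseq nv (tSnd (tVar 3))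
    ++ nseq nx (tbool false) ++ nseq nx tNil.

Definition enabled_term (t : raw_transition Sg) : tm :=
  tand (component nargs (raw_src t))
    (tand (tIsTag (raw_lab t) (tFst (tVar 3)))
       (tand (test_def access1 (raw_guard t))
             (test_val access1 (tSnd (tVar 3)) (raw_guard t)))).

Definition out_terms : tm :=
  foldr (fun q => tIf (component nargs q)
             (out_term access0 (lref nargs) (nth None (raw_out R) q)))
    (fail (lref nargs)) (iota 0 nq).

Definition trans_terms : tm :=
  foldr (fun t => tIf (enabled_term t) (call (trans_args t))) (call dead_args)
    (raw_trans R).

Definition body : tm :=
  tIf (tIsNil (lref nargs)) out_terms (tLet 3 (tHead (lref nargs)) trans_terms).

Definition init_args (d : D) : seq tm :=
  state_flags (raw_init R) ++ nseq nv (tbool false) ++ nseq nv (tConst (CData d))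
    ++ nseq nx (tbool true) ++ nseq nx tNil.

(* When D is empty, only the empty string has to be processed. *)
Definition body_empty : tm :=
  out_term (Access (fun _ => tbool false) (fun _ => tSnd (tHead (tVar 0)))
              (fun _ => tbool true) (fun _ => tNil))
    (tVar 0) (nth None (raw_out R) (raw_init R)).

Definition rec_fun (Ts : seq ty) (b : tm) (init : seq tm) : tm :=
  tFun 0 TList
    (tLetrec 1 (TArr (tprod TList Ts) TList) (tFun 0 (tprod TList Ts) b)
       (tApp (tVar 1) (tm_tuple (tVar 0) init))).

Definition raw_compile (od : option D) : tm :=
  if od is Some d then rec_fun arg_types body (init_args d)
  else rec_fun [::] body_empty [::].

End Body.

Definition compile (od : option D) (S : sdst Sg Sg) : tm := raw_compile (raw_of S) od.

End Compile.

(** * Computability of the translation *)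

Section RawEncoding.
Context {A : Type} {Sg : finType}.

Definition enc_raw_item (i : item Sg nat nat) : sexp A :=
  enc_list match i with
  | inl (c, v) => [:: enc_fin c; enc_num v]
  | inr x => [:: enc_num x]
  end.

Fixpoint enc_raw_test (phi : test nat) : sexp A :=
  enc_list match phi with
  | Btrue => [:: enc_num 0]
  | Bfalse => [:: enc_num 1]
  | Blt_curr v => [:: enc_num 2; enc_num v]
  | Bcurr_lt v => [:: enc_num 3; enc_num v]
  | Bnot p => [:: enc_num 4; enc_raw_test p]
  | Band p q => [:: enc_num 5; enc_raw_test p; enc_raw_test q]
  | Bor p q => [:: enc_num 6; enc_raw_test p; enc_raw_test q]
  end.

Definition enc_raw_transition (t : raw_transition Sg) : sexp A :=
  enc_list [:: enc_num (raw_src t); enc_fin (raw_lab t); enc_raw_test (raw_guard t);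
    enc_num (raw_dst t); enc_seq enc_num (raw_data t);
    enc_seq (enc_seq enc_raw_item) (raw_str t)].

Definition enc_items_option (o : option (seq (item Sg nat nat))) : sexp A :=
  enc_option (omap (enc_seq enc_raw_item) o).

Definition enc_raw (R : raw_sdst Sg) : sexp A :=
  enc_list [:: enc_num (raw_nq R); enc_num (raw_init R);
    enc_num (raw_nv R); enc_num (raw_curr R); enc_num (raw_nx R);
    enc_seq enc_items_option (raw_out R);
    enc_seq enc_raw_transition (raw_trans R)].

Lemma enc_raw_test_of (V : finType) (phi : test V) :
  enc_raw_test (map_test (@rank V) phi) = enc_test phi.
Proof. by elim: phi => //= [p -> | p -> q -> | p -> q ->]. Qed.

Lemma enc_raw_items_of (V X : finType) (s : seq (item Sg V X)) :
  enc_seq enc_raw_item (map (@raw_item Sg V X) s) = enc_str s.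
Proof. by rewrite /enc_seq -map_comp; congr enc_list; apply: eq_map => -[[c v]|x]. Qed.

Lemma enc_raw_of (S : sdst Sg Sg) : enc_raw (raw_of S) = enc_sdst S.
Proof.
rewrite /enc_raw /enc_sdst /= /enc_seq; do 4 congr SCons; congr (SCons _ _).
congr (SCons _ (SCons _ _)).
  rewrite -map_comp; congr enc_list; apply: eq_map => q /=.
  rewrite /enc_items_option; case: (out S q) => //= s.
  by congr (SCons _ _); apply: enc_raw_items_of.
rewrite -map_comp; congr enc_list; apply: eq_map => t /=.
rewrite /enc_raw_transition /enc_transition /= enc_raw_test_of /enc_seq -!map_comp.
congr (SCons _ (SCons _ (SCons _ (SCons _ (SCons _ (SCons _ _)))))).
by congr enc_list; apply: eq_map => x; apply: enc_raw_items_of.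
Qed.

End RawEncoding.

Section CompileComputable.
Context {Sg : finType} {disp : Order.disp_t} {D : orderType disp}.
Notation tm := (term Sg D).
Notation tbool b := (@tConst Sg D (CBool b)).
Notation enc_items := (enc_seq (@enc_raw_item D Sg)).
Notation enc_t := (@enc_term Sg disp D).

(** * Building codes of terms, types and tuples *)

Section Terms.
Variables (I : Type) (E : I -> sexp D).

Lemma cmp_cons2 (F G : I -> sexp D) c :
  cmp E F -> cmp E G -> cmp E (fun i => enc_list [:: c; F i; G i]).
Proof.
move=> HF HG; apply: cmp_cons; first exact: cmp_const.
by do 2 (apply: cmp_cons => //); apply: cmp_const.
Qed.

Lemma cmp_cons1 (F : I -> sexp D) c :
  cmp E F -> cmp E (fun i => enc_list [:: c; F i]).
Proof.
move=> HF; apply: cmp_cons; first exact: cmp_const.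
by apply: cmp_cons => //; apply: cmp_const.
Qed.

Lemma cmp_tBool (b : I -> bool) :
  cmp E (fun i => enc_num (b i)) -> cmp E (fun i => enc_t (tbool (b i))).
Proof. exact: cmp_cons1. Qed.

Lemma cmp_tTag (c : I -> Sg) :
  cmp E (fun i => enc_fin (c i)) -> cmp E (fun i => enc_t (tConst (CTag (c i)))).
Proof. exact: cmp_cons1. Qed.

Lemma cmp_tIf (t u v : I -> tm) :
  cmp E (fun i => enc_t (t i)) -> cmp E (fun i => enc_t (u i)) ->
  cmp E (fun i => enc_t (v i)) -> cmp E (fun i => enc_t (tIf (t i) (u i) (v i))).
Proof.
move=> Ht Hu Hv; apply: cmp_cons; first exact: cmp_const.
by do 3 (apply: cmp_cons => //); apply: cmp_const.
Qed.

Lemma cmp_tFst (t : I -> tm) :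
  cmp E (fun i => enc_t (t i)) -> cmp E (fun i => enc_t (tFst (t i))).
Proof. exact: cmp_cons1. Qed.

Lemma cmp_tSnd (t : I -> tm) :
  cmp E (fun i => enc_t (t i)) -> cmp E (fun i => enc_t (tSnd (t i))).
Proof. exact: cmp_cons1. Qed.

Lemma cmp_tHead (t : I -> tm) :
  cmp E (fun i => enc_t (t i)) -> cmp E (fun i => enc_t (tHead (t i))).
Proof. exact: cmp_cons1. Qed.

Lemma cmp_tTail (t : I -> tm) :
  cmp E (fun i => enc_t (t i)) -> cmp E (fun i => enc_t (tTail (t i))).
Proof. exact: cmp_cons1. Qed.

Lemma cmp_tIsNil (t : I -> tm) :
  cmp E (fun i => enc_t (t i)) -> cmp E (fun i => enc_t (tIsNil (t i))).
Proof. exact: cmp_cons1. Qed.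

Lemma cmp_tIsFalse (t : I -> tm) :
  cmp E (fun i => enc_t (t i)) -> cmp E (fun i => enc_t (tIsFalse (t i))).
Proof. exact: cmp_cons1. Qed.

Lemma cmp_tIsTag (c : I -> Sg) (t : I -> tm) :
  cmp E (fun i => enc_fin (c i)) -> cmp E (fun i => enc_t (t i)) ->
  cmp E (fun i => enc_t (tIsTag (c i) (t i))).
Proof. exact: cmp_cons2. Qed.

Lemma cmp_tPair (t u : I -> tm) :
  cmp E (fun i => enc_t (t i)) -> cmp E (fun i => enc_t (u i)) ->
  cmp E (fun i => enc_t (tPair (t i) (u i))).
Proof. exact: cmp_cons2. Qed.

Lemma cmp_tCons (t u : I -> tm) :
  cmp E (fun i => enc_t (t i)) -> cmp E (fun i => enc_t (u i)) ->
  cmp E (fun i => enc_t (tCons (t i) (u i))).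
Proof. exact: cmp_cons2. Qed.

Lemma cmp_tAppend (t u : I -> tm) :
  cmp E (fun i => enc_t (t i)) -> cmp E (fun i => enc_t (u i)) ->
  cmp E (fun i => enc_t (tAppend (t i) (u i))).
Proof. exact: cmp_cons2. Qed.

Lemma cmp_tLt (t u : I -> tm) :
  cmp E (fun i => enc_t (t i)) -> cmp E (fun i => enc_t (u i)) ->
  cmp E (fun i => enc_t (tLt (t i) (u i))).
Proof. exact: cmp_cons2. Qed.

Lemma cmp_tApp (t u : I -> tm) :
  cmp E (fun i => enc_t (t i)) -> cmp E (fun i => enc_t (u i)) ->
  cmp E (fun i => enc_t (tApp (t i) (u i))).
Proof. exact: cmp_cons2. Qed.

Lemma cmp_tLet (x : nat) (t u : I -> tm) :
  cmp E (fun i => enc_t (t i)) -> cmp E (fun i => enc_t (u i)) ->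
  cmp E (fun i => enc_t (tLet x (t i) (u i))).
Proof.
move=> Ht Hu; apply: cmp_cons; first exact: cmp_const.
exact: (cmp_cons2 (enc_num x)).
Qed.

Lemma cmp_tFun (x : nat) (T : I -> ty) (t : I -> tm) :
  cmp E (fun i => enc_ty (T i)) -> cmp E (fun i => enc_t (t i)) ->
  cmp E (fun i => enc_t (tFun x (T i) (t i))).
Proof.
move=> HT Ht; apply: cmp_cons; first exact: cmp_const.
exact: (cmp_cons2 (enc_num x)).
Qed.

Lemma cmp_tLetrec (x : nat) (T : I -> ty) (t u : I -> tm) :
  cmp E (fun i => enc_ty (T i)) -> cmp E (fun i => enc_t (t i)) ->
  cmp E (fun i => enc_t (u i)) ->
  cmp E (fun i => enc_t (tLetrec x (T i) (t i) (u i))).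
Proof.
move=> HT Ht Hu; do 2 (apply: cmp_cons; first exact: cmp_const).
by do 3 (apply: cmp_cons => //); apply: cmp_const.
Qed.

Lemma cmp_TProd (T U : I -> ty) :
  cmp E (fun i => enc_ty (T i)) -> cmp E (fun i => enc_ty (U i)) ->
  cmp E (fun i => enc_ty (TProd (T i) (U i))).
Proof. exact: cmp_cons2. Qed.

Lemma cmp_TArr (T U : I -> ty) :
  cmp E (fun i => enc_ty (T i)) -> cmp E (fun i => enc_ty (U i)) ->
  cmp E (fun i => enc_ty (TArr (T i) (U i))).
Proof. exact: cmp_cons2. Qed.

Lemma cmp_tand (t u : I -> tm) :
  cmp E (fun i => enc_t (t i)) -> cmp E (fun i => enc_t (u i)) ->
  cmp E (fun i => enc_t (tand (t i) (u i))).
Proof. by move=> Ht Hu; apply: cmp_tIf => //; apply: cmp_const. Qed.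

End Terms.

Section Tuples.
Variables (I : Type) (E : I -> sexp D).

Lemma cmp_tm_tuple (t : I -> tm) (ts : I -> seq tm) :
  cmp E (fun i => enc_t (t i)) -> cmp E (fun i => enc_seq enc_t (ts i)) ->
  cmp E (fun i => enc_t (tm_tuple (t i) (ts i))).
Proof.
move=> Ht Hts; apply: (cmp_foldl (f := fun _ => @tPair Sg D) Hts Ht) => /=.
apply: cmp_tPair; first exact: (cmp_snd _ enc_t).
exact: (@cmp_fst _ (I * tm) tm _ _ _ (cmp_snd (fun z => E z.1) enc_t)).
Qed.

Lemma cmp_tprod (T : I -> ty) (Ts : I -> seq ty) :
  cmp E (fun i => enc_ty (T i)) -> cmp E (fun i => enc_seq enc_ty (Ts i)) ->
  cmp E (fun i => enc_ty (tprod (T i) (Ts i))).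
Proof.
move=> HT HTs; apply: (cmp_foldl (f := fun _ => TProd) HTs HT) => /=.
apply: cmp_TProd; first exact: (cmp_snd _ enc_ty).
exact: (@cmp_fst _ (I * ty) ty _ _ _ (cmp_snd (fun z => E z.1) enc_ty)).
Qed.

Lemma cmp_lref (n : I -> nat) :
  cmp E (fun i => enc_num (n i)) -> cmp E (fun i => enc_t (lref (n i))).
Proof.
move=> Hn; apply: (cmp_iter (f := fun _ => @tFst Sg D) (encY := enc_t) Hn) => /=.
  exact: cmp_const.
by apply: cmp_tFst; exact: cmp_snd.
Qed.

Lemma cmp_compk (n k : I -> nat) :
  cmp E (fun i => enc_num (n i)) -> cmp E (fun i => enc_num (k i)) ->
  cmp E (fun i => enc_t (component (n i) (k i))).
Proof.
move=> Hn Hk; apply: cmp_tSnd.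
apply: (cmp_lref (n := fun i => n i - (k i).+1)).
by apply: cmp_subn => //; apply: cmp_S.
Qed.

End Tuples.

(* The code of a variable item is a list of length 1, that of a letter item a
   list of length 2. *)
Lemma cmp_item_case I (E : I -> sexp D) (G : I -> item Sg nat nat -> sexp D) :
  cmp (fun z : I * (Sg * nat) => SCons (E z.1) (SCons (enc_fin z.2.1) (enc_num z.2.2)))
      (fun z => G z.1 (inl z.2)) ->
  cmp (fun z : I * nat => SCons (E z.1) (enc_num z.2)) (fun z => G z.1 (inr z.2)) ->
  cmp (fun z : I * item Sg nat nat => SCons (E z.1) (enc_raw_item z.2))
      (fun z => G z.1 z.2).
Proof.
move=> Hl Hr.
pose F (z : I * item Sg nat nat) : sexp D := if z.2 is inl _ then SCons SNil SNil else SNil.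
have HF : cmp (fun z => SCons (E z.1) (enc_raw_item z.2)) F.
  by exists [::], (PIf (PCdr (PCdr (PInput D))) (PQuote (SCons SNil SNil)) (PQuote SNil))
    => -[i [[c v]|x]] /=; [apply: RunIf | apply: RunIfNil]; repeat econstructor.
apply: (@cmp_case _ _ _ F _ (I * (Sg * nat))%type (I * nat)%type
   (fun z => (z.1, inl z.2)) (fun z => (z.1, inr z.2))); first exact: HF.
- case=> i [[c v]|x]; [right | left]; split=> //; first by exists (i, (c, v)).
  by exists (i, x).
- apply: cmp_comp Hl; exists [::], (PCons (PCar (PInput D)) (PCons
    (PCar (PCdr (PInput D))) (PCar (PCdr (PCdr (PInput D)))))) => -[i [c v]] /=.
  by repeat econstructor.
- apply: cmp_comp Hr; exists [::], (PCons (PCar (PInput D))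
    (PCar (PCdr (PInput D)))) => -[i x] /=.
  by repeat econstructor.
Qed.

Section Access.
Variables (I : Type) (E : I -> sexp D).

(** Accessors are functions and have no code of their own. They are treated as computable families,
    taking the environment paired with the number of a variable to a term. *)
Definition cmp_access (A : I -> @access Sg disp D) : Prop :=
  [/\ cmp (fun z : I * nat => SCons (E z.1) (enc_num z.2))
          (fun z => enc_t (data_def (A z.1) z.2)),
      cmp (fun z : I * nat => SCons (E z.1) (enc_num z.2))
          (fun z => enc_t (data_val (A z.1) z.2)),
      cmp (fun z : I * nat => SCons (E z.1) (enc_num z.2))
          (fun z => enc_t (str_def (A z.1) z.2))
    & cmp (fun z : I * nat => SCons (E z.1) (enc_num z.2))
          (fun z => enc_t (str_val (A z.1) z.2))].

Variables (A : I -> @access Sg disp D).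
Hypothesis HA : cmp_access A.

Lemma cmp_item_def :
  cmp (fun z : I * item Sg nat nat => SCons (E z.1) (enc_raw_item z.2))
      (fun z => enc_t (item_def (A z.1) z.2)).
Proof.
case: HA => Hd _ Hs _.
apply: (cmp_item_case (G := fun i t => enc_t (item_def (A i) t))) => //=.
pose u (z : I * (Sg * nat)) := (z.1, z.2.2).
have := cmp_sub u Hd; apply: cmp_comp.
by exists [::], (PCons (PCar (PInput D)) (PCdr (PCdr (PInput D)))) => -[i [c v]] /=;
   repeat econstructor.
Qed.

Lemma cmp_item_val :
  cmp (fun z : I * item Sg nat nat * tm =>
         SCons (SCons (E z.1.1) (enc_raw_item z.1.2)) (enc_t z.2))
      (fun z => enc_t (item_val (A z.1.1) z.1.2 z.2)).
Proof.
case: HA => _ Hd _ Hs.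
pose E' (z : I * tm) := SCons (E z.1) (enc_t z.2).
(* [cmp_item_case] expects the item in the last place, so the accumulated term is moved into the
   environment. *)
have swap : cmp (fun z : I * item Sg nat nat * tm =>
     SCons (SCons (E z.1.1) (enc_raw_item z.1.2)) (enc_t z.2))
   (fun z => SCons (E' (z.1.1, z.2)) (enc_raw_item z.1.2)).
  exists [::], (PCons (PCons (PCar (PCar (PInput D))) (PCdr (PInput D)))
    (PCdr (PCar (PInput D)))) => -[[i x] t] /=.
  by repeat econstructor.
apply: (cmp_comp swap).
have := @cmp_item_case _ E' (fun i x => enc_t (item_val (A i.1) x i.2)).
move=> C; refine (cmp_sub (fun z : I * item Sg nat nat * tm => (z.1.1, z.2, z.1.2)) (C _ _)).
- apply: cmp_tCons.
    apply: cmp_tPair.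
      apply: cmp_tTag.
      by exists [::], (PCar (PCdr (PInput D))) => z /=; repeat econstructor.
    have := cmp_sub (fun z : I * tm * (Sg * nat) => (z.1.1, z.2.2)) Hd; apply: cmp_comp.
    by exists [::], (PCons (PCar (PCar (PInput D))) (PCdr (PCdr (PInput D)))) => z /=;
      repeat econstructor.
  by exists [::], (PCdr (PCar (PInput D))) => z /=; repeat econstructor.
- apply: cmp_tAppend.
    have := cmp_sub (fun z : I * tm * nat => (z.1.1, z.2)) Hs; apply: cmp_comp.
    by exists [::], (PCons (PCar (PCar (PInput D))) (PCdr (PInput D))) => z /=;
      repeat econstructor.
  by exists [::], (PCdr (PCar (PInput D))) => z /=; repeat econstructor.
Qed.

Lemma cmp_items_def :
  cmp (fun z : I * seq (item Sg nat nat) => SCons (E z.1) (enc_items z.2))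
      (fun z => enc_t (items_def (A z.1) z.2)).
Proof.
apply: (cmp_foldr (f := fun i x => tand (item_def (A i.1) x))
          (y := fun _ => tbool true) (encY := enc_t)).
- exact: cmp_snd.
- exact: cmp_const.
apply: cmp_tand; last exact: (cmp_snd _ enc_t).
pose u (z : I * seq (item Sg nat nat) * item Sg nat nat * tm) := (z.1.1.1, z.1.2).
have := cmp_sub u cmp_item_def.
apply: cmp_comp.
by exists [::], (PCons (PCar (PCar (PCar (PInput D)))) (PCdr (PCar (PInput D)))) => z /=;
  repeat econstructor.
Qed.

Lemma cmp_items_val :
  cmp (fun z : I * seq (item Sg nat nat) => SCons (E z.1) (enc_items z.2))
      (fun z => enc_t (items_val (A z.1) z.2)).
Proof.
apply: (cmp_foldr (f := fun i x => item_val (A i.1) x)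
          (y := fun _ => tNil) (encY := enc_t)).
- exact: cmp_snd.
- exact: cmp_const.
pose u (z : I * seq (item Sg nat nat) * item Sg nat nat * tm) := (z.1.1.1, z.1.2, z.2).
have := cmp_sub u cmp_item_val.
apply: cmp_comp.
by exists [::], (PCons (PCons (PCar (PCar (PCar (PInput D)))) (PCdr (PCar (PInput D))))
    (PCdr (PInput D))) => z /=;
  repeat econstructor.
Qed.

Lemma cmp_out_term (l : I -> tm) :
  cmp E (fun i => enc_t (l i)) ->
  cmp (fun z : I * option (seq (item Sg nat nat)) => SCons (E z.1) (enc_items_option z.2))
      (fun z => enc_t (out_term (A z.1) (l z.1) z.2)).
Proof.
move=> Hl; have Hf : cmp E (fun i => enc_t (fail (l i))).
  by apply: cmp_tCons; [apply: cmp_tHead | apply: cmp_const].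
apply: (@cmp_case _ _ _ (fun z => enc_items_option z.2) _ (I * seq (item Sg nat nat))%type I
   (fun z => (z.1, Some z.2)) (fun z => (z, None))); first exact: cmp_snd.
- by case=> i [s|]; [right | left]; split=> //; [exists (i, s) | exists i].
- have unwrap : cmp (fun z : I * seq (item Sg nat nat) =>
        SCons (E z.1) (enc_items_option (Some z.2)))
      (fun z => SCons (E z.1) (enc_items z.2)).
    by exists [::], (PCons (PCar (PInput D)) (PCar (PCdr (PInput D)))) => z /=;
      repeat econstructor.
  apply: (cmp_comp unwrap); apply: cmp_tIf; first exact: cmp_items_def.
    exact: cmp_items_val.
  exact: (cmp_fst _ Hf).
- apply: cmp_comp Hf.
  by exists [::], (PCar (PInput D)) => z /=; repeat econstructor.
Qed.

Lemma cmp_test_def :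
  cmp (fun z : I * test nat => SCons (E z.1) (enc_raw_test z.2))
      (fun z => enc_t (test_def (A z.1) z.2)).
Proof.
case: HA => Hd _ _ _.
have Hand : cmp (fun z : I * test nat * test nat =>
    SCons (SCons (E z.1.1) (enc_t (test_def (A z.1.1) z.1.2)))
      (enc_t (test_def (A z.1.1) z.2)))
  (fun z => enc_t (tand (test_def (A z.1.1) z.1.2) (test_def (A z.1.1) z.2))).
  by apply: cmp_tand; [exists [::], (PCdr (PCar (PInput D))) => z
    | exists [::], (PCdr (PInput D)) => z]; repeat econstructor.
apply: (cmp_test_rec (enc := enc_num) (f := fun i t => enc_t (test_def (A i) t))) => //.
- by case.
- exact: cmp_const.
- exact: cmp_const.
- by exists [::], (PCdr (PInput D)) => z /=; repeat econstructor.
Qed.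

Lemma cmp_test_val (c : I -> tm) :
  cmp E (fun i => enc_t (c i)) ->
  cmp (fun z : I * test nat => SCons (E z.1) (enc_raw_test z.2))
      (fun z => enc_t (test_val (A z.1) (c z.1) z.2)).
Proof.
case: HA => _ Hd _ _ Hc.
pose f i t := enc_t (test_val (A i) (c i) t).
have arg1 : cmp (fun z : I * test nat * test nat =>
    SCons (SCons (E z.1.1) (f z.1.1 z.1.2)) (f z.1.1 z.2)) (fun z => f z.1.1 z.1.2).
  by exists [::], (PCdr (PCar (PInput D))) => z; repeat econstructor.
have arg2 : cmp (fun z : I * test nat * test nat =>
    SCons (SCons (E z.1.1) (f z.1.1 z.1.2)) (f z.1.1 z.2)) (fun z => f z.1.1 z.2).
  by exists [::], (PCdr (PInput D)) => z; repeat econstructor.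
apply: (cmp_test_rec (enc := enc_num) (f := f)) => //.
- by case.
- exact: cmp_const.
- exact: cmp_const.
- by apply: cmp_tLt => //; exact: (cmp_fst _ Hc).
- by apply: cmp_tLt => //; exact: (cmp_fst _ Hc).
- by apply: cmp_tIsFalse; exists [::], (PCdr (PInput D)) => z; repeat econstructor.
- exact: cmp_tand.
- by apply: cmp_tIf => //; exact: cmp_const.
Qed.

End Access.

Notation enc_r := (@enc_raw D Sg).

Lemma cmp_raw_num : [/\ cmp enc_r (fun R => enc_num (raw_nq R)),
  cmp enc_r (fun R => enc_num (raw_init R)), cmp enc_r (fun R => enc_num (raw_nv R)),
  cmp enc_r (fun R => enc_num (raw_curr R)) & cmp enc_r (fun R => enc_num (raw_nx R))].
Proof.
have H k (F : raw_sdst Sg -> sexp D) :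
    (forall R, runs [::] (PCar (iter k (@PCdr D) (PInput D))) (enc_r R) (F R)) ->
    cmp enc_r F by move=> r; exists [::], (PCar (iter k (@PCdr D) (PInput D))).
split; [apply: (H 0) | apply: (H 1) | apply: (H 2) | apply: (H 3) | apply: (H 4)];
  by move=> R; repeat econstructor.
Qed.

Lemma cmp_raw_out : cmp enc_r (fun R => enc_seq enc_items_option (raw_out R)).
Proof. by exists [::], (PCar (iter 5 (@PCdr D) (PInput D))) => R; repeat econstructor. Qed.

Lemma cmp_raw_trans : cmp enc_r (fun R => enc_seq enc_raw_transition (raw_trans R)).
Proof. by exists [::], (PCar (iter 6 (@PCdr D) (PInput D))) => R; repeat econstructor. Qed.

Lemma cmp_nargs : cmp enc_r (fun R => enc_num (nargs R)).
Proof. by case: cmp_raw_num => *; repeat apply: cmp_add. Qed.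

Lemma cmp_access0 : cmp_access enc_r (@access0 Sg disp D).
Proof.
case: cmp_raw_num => Hq _ Hv _ Hx; have Hn := cmp_nargs.
by split; apply: cmp_compk; first [exact: (cmp_fst _ Hn) |
   repeat (apply: cmp_add; first first); first [exact: cmp_snd
     | exact: (cmp_fst _ Hq) | exact: (cmp_fst _ Hv) | exact: (cmp_fst _ Hx)]].
Qed.

Lemma cmp_access1 : cmp_access enc_r (@access1 Sg disp D).
Proof.
case: cmp_raw_num => _ _ _ Hc _; case: cmp_access0 => H1 H2 H3 H4.
have He : cmp (fun z : raw_sdst Sg * nat => SCons (enc_r z.1) (enc_num z.2))
    (fun z => enc_num (z.2 == raw_curr z.1)).
  by apply: cmp_eqn; [exact: cmp_snd | exact: (cmp_fst _ Hc)].
by split => //; apply: (cmp_ifb (encY := enc_t)) => //; apply: cmp_const.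
Qed.

Lemma cmp_call (I : Type) (E : I -> sexp D) (R : I -> raw_sdst Sg) (args : I -> seq tm) :
  cmp E (fun i => enc_r (R i)) -> cmp E (fun i => enc_seq enc_t (args i)) ->
  cmp E (fun i => enc_t (call (R i) (args i))).
Proof.
move=> HR Ha; apply: cmp_tLet; last exact: cmp_const.
apply: cmp_tApp; first exact: cmp_const.
apply: cmp_tm_tuple => //; apply: cmp_tTail; apply: cmp_lref.
exact: (cmp_comp HR (cmp_sub R cmp_nargs)).
Qed.

Lemma cmp_state_flags (I : Type) (E : I -> sexp D) (R : I -> raw_sdst Sg) (k : I -> nat) :
  cmp E (fun i => enc_r (R i)) -> cmp E (fun i => enc_num (k i)) ->
  cmp E (fun i => enc_seq enc_t (state_flags (R i) (k i))).
Proof.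
move=> HR Hk; case: cmp_raw_num => Hq _ _ _ _.
apply: (cmp_map (f := fun i q => tbool (q == k i)) (encX := enc_num)).
  exact: (cmp_iota (cmp_comp HR (cmp_sub R Hq))).
by apply: cmp_tBool; apply: cmp_eqn; [exact: cmp_snd | exact: (cmp_fst _ Hk)].
Qed.

Lemma cmp_dead_args : cmp enc_r (fun R => enc_seq enc_t (dead_args R)).
Proof.
case: cmp_raw_num => Hq _ Hv _ Hx.
apply: cmp_cat; first exact: (cmp_state_flags (R := id) (cmp_input _)).
by repeat apply: cmp_cat; apply: cmp_nseq => //; apply: cmp_const.
Qed.

Lemma cmp_init_args (d : D) : cmp enc_r (fun R => enc_seq enc_t (init_args R d)).
Proof.
case: cmp_raw_num => Hq Hi Hv _ Hx.
apply: cmp_cat; first exact: (cmp_state_flags (R := id) (cmp_input _)).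
by repeat apply: cmp_cat; apply: cmp_nseq => //; apply: cmp_const.
Qed.

Lemma cmp_arg_types : cmp enc_r (fun R => enc_seq enc_ty (arg_types R)).
Proof.
case: cmp_raw_num => Hq Hi Hv _ Hx.
by repeat apply: cmp_cat; apply: cmp_nseq => //; apply: cmp_const.
Qed.

Section Transitions.
Notation RT := (raw_sdst Sg * raw_transition Sg)%type.
Let ET (z : RT) : sexp D := SCons (enc_r z.1) (enc_raw_transition z.2).

Let cmp_R : cmp ET (fun z => enc_r z.1).
Proof. exact: cmp_car (cmp_input _). Qed.

(** The mapped function depends on the transducer only, so the transition is dropped from the
    environment before it is applied. *)
Lemma cmp_map_access X (encX : X -> sexp D) (f : raw_sdst Sg -> X -> tm) (s : RT -> seq X) :
  cmp ET (fun z => enc_seq encX (s z)) ->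
  cmp (fun z : raw_sdst Sg * X => SCons (enc_r z.1) (encX z.2)) (fun z => enc_t (f z.1 z.2)) ->
  cmp ET (fun z => enc_seq enc_t (map (f z.1) (s z))).
Proof.
move=> Hs Hf; apply: (cmp_map (f := fun z => f z.1) Hs).
refine (cmp_comp _ (cmp_sub (fun z : RT * X => (z.1.1, z.2)) Hf)).
apply: cmp_cons; first exact: (cmp_fst _ cmp_R).
exact: cmp_snd.
Qed.

Lemma cmp_trans_args : cmp ET (fun z => enc_seq enc_t (trans_args z.1 z.2)).
Proof.
have Hd : cmp ET (fun z => enc_seq enc_num (raw_data z.2)).
  by exists [::], (PCar (iter 5 (@PCdr D) (PInput D))) => R; repeat econstructor.
have Hs : cmp ET (fun z => enc_seq (enc_seq enc_raw_item) (raw_str z.2)).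
  by exists [::], (PCar (iter 6 (@PCdr D) (PInput D))) => R; repeat econstructor.
case: cmp_access1 => H1 H2 _ _.
apply: cmp_cat.
  apply: (cmp_state_flags (R := fst)) => //.
  by exists [::], (PCar (iter 4 (@PCdr D) (PInput D))) => R; repeat econstructor.
apply: cmp_cat; first exact: (cmp_map_access (f := fun R => data_def (access1 R)) Hd H1).
apply: cmp_cat; first exact: (cmp_map_access (f := fun R => data_val (access1 R)) Hd H2).
apply: cmp_cat.
  exact: (cmp_map_access (f := fun R => items_def (access1 R)) Hs (cmp_items_def cmp_access1)).
exact: (cmp_map_access (f := fun R => items_val (access1 R)) Hs (cmp_items_val cmp_access1)).
Qed.

Lemma cmp_enabled_term : cmp ET (fun z => enc_t (enabled_term z.1 z.2)).
Proof.
have Hg : cmp ET (fun z => SCons (enc_r z.1) (enc_raw_test (raw_guard z.2))).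
  exists [::], (PCons (PCar (PInput D)) (PCar (iter 3 (@PCdr D) (PInput D)))) => z.
  by repeat econstructor.
apply: cmp_tand.
  apply: cmp_compk; first exact: (cmp_comp cmp_R (cmp_sub fst cmp_nargs)).
  by exists [::], (PCar (iter 1 (@PCdr D) (PInput D))) => R; repeat econstructor.
apply: cmp_tand.
  apply: cmp_tIsTag; last exact: cmp_const.
  by exists [::], (PCar (iter 2 (@PCdr D) (PInput D))) => R; repeat econstructor.
have Hd := cmp_test_def cmp_access1.
have Hv := cmp_test_val cmp_access1 (cmp_const _ (enc_t (tSnd (tVar 3)))).
apply: cmp_tand.
  exact: (cmp_comp Hg (cmp_sub (fun z : RT => (z.1, raw_guard z.2)) Hd)).
exact: (cmp_comp Hg (cmp_sub (fun z : RT => (z.1, raw_guard z.2)) Hv)).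
Qed.

End Transitions.

Lemma cmp_trans_terms : cmp enc_r (fun R => enc_t (trans_terms R)).
Proof.
apply: (cmp_foldr (encX := enc_raw_transition) (encY := enc_t)
  (f := fun R t => tIf (enabled_term R t) (call R (trans_args R t)))).
- exact: cmp_raw_trans.
- exact: (cmp_call (R := id) (cmp_input _) cmp_dead_args).
have Hc := cmp_call (R := fst) (args := fun z => trans_args z.1 z.2)
             (cmp_car (cmp_input _)) cmp_trans_args.
apply: cmp_tIf; [exact: (cmp_fst _ cmp_enabled_term) | exact: (cmp_fst _ Hc) |].
exact: (cmp_snd _ enc_t).
Qed.

Lemma cmp_out_terms : cmp enc_r (fun R => enc_t (out_terms R)).
Proof.
have Hl := cmp_lref cmp_nargs.
case: cmp_raw_num => Hq _ _ _ _.
apply: (cmp_foldr (encX := enc_num) (encY := enc_t)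
  (f := fun R q => tIf (component (nargs R) q)
          (out_term (access0 R) (lref (nargs R)) (nth None (raw_out R) q)))).
- exact: cmp_iota.
- by apply: cmp_tCons; [apply: cmp_tHead | apply: cmp_const].
apply: cmp_tIf; last exact: (cmp_snd _ enc_t).
  apply: (cmp_fst (E := fun z : raw_sdst Sg * nat => SCons (enc_r z.1) (enc_num z.2))
    (G := fun z => enc_t (component (nargs z.1) z.2))).
  by apply: cmp_compk; [exact: (cmp_fst _ cmp_nargs) | exact: cmp_snd].
apply: (cmp_fst (E := fun z : raw_sdst Sg * nat => SCons (enc_r z.1) (enc_num z.2))
    (G := fun z => enc_t (out_term (access0 z.1) (lref (nargs z.1))
                            (nth None (raw_out z.1) z.2)))).
pose u (z : raw_sdst Sg * nat) := (z.1, nth None (raw_out z.1) z.2).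
refine (cmp_comp _ (cmp_sub u (cmp_out_term cmp_access0 Hl))).
apply: cmp_cons; first exact: cmp_car (cmp_input _).
apply: cmp_nth; first exact: cmp_snd.
exact: (cmp_fst _ cmp_raw_out).
Qed.

Lemma cmp_body : cmp enc_r (fun R => enc_t (body R)).
Proof.
have Hl := cmp_lref cmp_nargs.
apply: cmp_tIf; [exact: cmp_tIsNil | exact: cmp_out_terms | apply: cmp_tLet].
  exact: cmp_tHead.
exact: cmp_trans_terms.
Qed.

Lemma cmp_body_empty : cmp enc_r (fun R => enc_t (body_empty R)).
Proof.
case: cmp_raw_num => _ Hi _ _ _; rewrite /body_empty.
set Ac := Access _ _ _ _.
have HA : cmp_access enc_r (fun _ => Ac) by split; apply: cmp_const.
have := @cmp_out_term _ enc_r _ HA (fun _ => tVar 0) (cmp_const _ _).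
move/(cmp_sub (fun R => (R, nth None (raw_out R) (raw_init R)))); apply: cmp_comp.
apply: cmp_cons; first exact: cmp_input.
by apply: cmp_nth => //; exact: cmp_raw_out.
Qed.

Lemma cmp_rec_fun (Ts : raw_sdst Sg -> seq ty) (b : raw_sdst Sg -> tm)
    (init : raw_sdst Sg -> seq tm) :
  cmp enc_r (fun R => enc_seq enc_ty (Ts R)) -> cmp enc_r (fun R => enc_t (b R)) ->
  cmp enc_r (fun R => enc_seq enc_t (init R)) ->
  cmp enc_r (fun R => enc_t (rec_fun (Ts R) (b R) (init R))).
Proof.
move=> HT Hb Hi.
have HP : cmp enc_r (fun R => enc_ty (tprod TList (Ts R))).
  by apply: cmp_tprod => //; apply: cmp_const.
apply: cmp_tFun; first exact: cmp_const.
apply: cmp_tLetrec; first by apply: cmp_TArr => //; apply: cmp_const.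
  exact: cmp_tFun.
apply: cmp_tApp; first exact: cmp_const.
by apply: cmp_tm_tuple => //; apply: cmp_const.
Qed.

(** The datum occurs in the program as a quoted atom, inside the constant part of the initial
    arguments; each [od] thus has its own program. *)
Lemma computable_compile (od : option D) :
  computable (@enc_sdst D Sg Sg) enc_t (compile od).
Proof.
have [d [p Hp]]: cmp enc_r (fun R => enc_t (raw_compile R od)).
  case: od => [d|]; apply: cmp_rec_fun.
  - exact: cmp_arg_types.
  - exact: cmp_body.
  - exact: cmp_init_args.
  - exact: cmp_const.
  - exact: cmp_body_empty.
  - exact: cmp_const.
by exists d, p => S; rewrite -enc_raw_of; apply: Hp.
Qed.

End CompileComputable.

(** * The syntactic conditions *)

Section Expressions.
Context {Sg : finType} {disp : Order.disp_t} {D : orderType disp}.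
Notation tm := (term Sg D).
Notation tbool b := (@tConst Sg D (CBool b)).

Lemma all_subterms_sub (p q : pred tm) t :
  (forall u, p u -> q u) -> all_subterms p t -> all_subterms q t.
Proof.
move=> pq; elim: t; rewrite /all_subterms /=; intros;
  repeat match goal with H : is_true (_ && _) |- _ => case/andP: H => ? ? end;
  repeat (apply/andP; split); auto.
Qed.

Lemma tprod_rcons T Ts U : tprod T (rcons Ts U) = TProd (tprod T Ts) U.
Proof. by rewrite /tprod foldl_rcons. Qed.

Lemma fst_depth_iter j : fst_depth 0 (iter j (@tFst Sg D) (tVar 0)) = Some j.
Proof. by elim: j => //= j ->. Qed.

Lemma as_comp_lref n : as_comp 0 n (@lref Sg _ D n) = Some 0.
Proof.
have := fst_depth_iter n; rewrite /as_comp /lref.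
by case: n => [|n] //= ->; rewrite eqxx.
Qed.

Lemma as_comp_comp n k : k < n -> as_comp 0 n (@component Sg _ D n k) = Some k.+1.
Proof.
by move=> ltkn; rewrite /as_comp /component fst_depth_iter ifT; [congr (Some _)|]; lia.
Qed.

Lemma has_type_fsts G Ts j :
  G 0 = Some (tprod TList Ts) -> j <= size Ts ->
  has_type G (iter j (@tFst Sg D) (tVar 0)) (tprod TList (take (size Ts - j) Ts)).
Proof.
move=> G0; elim: j => [|j IH] ltj /=.
  by rewrite subn0 take_size; apply: HT_var.
have lt : size Ts - j.+1 < size Ts by lia.
have := IH (ltnW ltj); rewrite (_ : size Ts - j = (size Ts - j.+1).+1); last lia.
by rewrite (take_nth TBool lt) tprod_rcons; apply: HT_fst.
Qed.

Lemma has_type_lref G Ts :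
  G 0 = Some (tprod TList Ts) -> has_type G (@lref Sg _ D (size Ts)) TList.
Proof. by move=> G0; have := has_type_fsts G0 (leqnn _); rewrite subnn take0. Qed.

Lemma has_type_comp G Ts k :
  G 0 = Some (tprod TList Ts) -> k < size Ts ->
  has_type G (@component Sg _ D (size Ts) k) (nth TBool Ts k).
Proof.
move=> G0 ltk; have := has_type_fsts G0 (leq_subr k.+1 _).
by rewrite subKn // (take_nth TBool ltk) tprod_rcons; apply: HT_snd.
Qed.

Lemma has_type_tuple G (t : tm) ts T Ts :
  has_type G t T -> List.Forall2 (has_type G) ts Ts ->
  has_type G (tm_tuple t ts) (tprod T Ts).
Proof.
move=> Ht Hts; elim: Hts t T Ht => //= u U us Us Hu _ IH t T Ht.
by apply: IH; apply: HT_pair.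
Qed.

Lemma Forall2_nseq X Y (P : X -> Y -> Prop) n x y :
  P x y -> List.Forall2 P (nseq n x) (nseq n y).
Proof. by move=> Pxy; elim: n => //= n IH; constructor. Qed.

Lemma Forall2_map_nseq (X : eqType) Y Z (P : Y -> Z -> Prop) (f : X -> Y) s n y :
  n = size s -> (forall x, x \in s -> P (f x) y) -> List.Forall2 P (map f s) (nseq n y).
Proof.
move=> ->; elim: s => //= x s IH Ps; constructor; first exact/Ps/mem_head.
by apply: IH => z zs; apply: Ps; rewrite inE zs orbT.
Qed.

(* Most syntactic conditions on a body hold because it only has such nodes. *)
Definition body_node (n : nat) (u : tm) : bool :=
  match u with
  | tFun _ _ _ | tLetrec _ _ _ _ | tConst (CData _) => false
  | tLet y _ _ => 1 < y
  | tIsNil v | tHead v | tTail v => as_comp 0 n v == Some 0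
  | _ => true
  end.

(* For the parts of a body without recursive calls. *)
Definition simple_node (n : nat) (u : tm) : bool :=
  match u with tVar y => y != 1 | tLet _ _ _ => false | _ => body_node n u end.

(** Typing and the syntactic conditions follow the construction of a term in the same way, so they
    are bundled and proved in a single pass over it. *)
Definition expr (G : nat -> option ty) (n : nat) (T : ty) (t : tm) : Prop :=
  has_type G t T /\ all_subterms (simple_node n) t.

Section Expr.
Variables (G : nat -> option ty) (n : nat).
Notation exprG := (expr G n).

Lemma expr_bool b : exprG TBool (tbool b).
Proof. by split=> //; apply: (@HT_const _ _ _ _ (CBool b)). Qed.

Lemma expr_tag c : exprG TTag (tConst (CTag c)).
Proof. by split=> //; apply: (@HT_const _ _ _ _ (CTag c)). Qed.

Lemma expr_nil : exprG TList tNil.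
Proof. by split=> //; apply: HT_nil. Qed.

Lemma expr_var x T : G x = Some T -> x != 1 -> exprG T (tVar x).
Proof. by move=> Gx x1; split; [apply: HT_var | rewrite /all_subterms /= x1]. Qed.

Lemma expr_if T t u v :
  exprG TBool t -> exprG T u -> exprG T v -> exprG T (tIf t u v).
Proof.
move=> [? pt] [? pu] [? pv]; split; first exact: HT_if.
by move: pt pu pv; rewrite /all_subterms /= => -> -> ->.
Qed.

Lemma expr_and t u : exprG TBool t -> exprG TBool u -> exprG TBool (tand t u).
Proof. by move=> Ht Hu; apply: expr_if => //; apply: expr_bool. Qed.

Lemma expr_isfalse t : exprG TBool t -> exprG TBool (tIsFalse t).
Proof.
by move=> [? pt]; split; [exact: HT_isfalse | move: pt; rewrite /all_subterms /= => ->].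
Qed.

Lemma expr_istag c t : exprG TTag t -> exprG TBool (tIsTag c t).
Proof.
by move=> [? pt]; split; [exact: HT_istag | move: pt; rewrite /all_subterms /= => ->].
Qed.

Lemma expr_lt t u : exprG TData t -> exprG TData u -> exprG TBool (tLt t u).
Proof.
move=> [? pt] [? pu]; split; first exact: HT_lt.
by move: pt pu; rewrite /all_subterms /= => -> ->.
Qed.

Lemma expr_pair T U t u : exprG T t -> exprG U u -> exprG (TProd T U) (tPair t u).
Proof.
move=> [? pt] [? pu]; split; first exact: HT_pair.
by move: pt pu; rewrite /all_subterms /= => -> ->.
Qed.

Lemma expr_cons t u :
  exprG (TProd TTag TData) t -> exprG TList u -> exprG TList (tCons t u).
Proof.
move=> [? pt] [? pu]; split; first exact: HT_cons.
by move: pt pu; rewrite /all_subterms /= => -> ->.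
Qed.

Lemma expr_append t u : exprG TList t -> exprG TList u -> exprG TList (tAppend t u).
Proof.
move=> [? pt] [? pu]; split; first exact: HT_append.
by move: pt pu; rewrite /all_subterms /= => -> ->.
Qed.

Lemma expr_fst T U t : exprG (TProd T U) t -> exprG T (tFst t).
Proof.
move=> [? pt]; split; first exact: (@HT_fst _ _ _ _ _ U).
by move: pt; rewrite /all_subterms /= => ->.
Qed.

Lemma expr_snd T U t : exprG (TProd T U) t -> exprG U (tSnd t).
Proof.
move=> [? pt]; split; first exact: (@HT_snd _ _ _ _ T).
by move: pt; rewrite /all_subterms /= => ->.
Qed.

Lemma simple_fsts j : all_subterms (simple_node n) (iter j (@tFst Sg D) (tVar 0)).
Proof. by elim: j => //= j; rewrite /all_subterms /= => ->. Qed.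

Hypothesis G0 : exists2 Ts, size Ts = n & G 0 = Some (tprod TList Ts).

Lemma expr_lref : exprG TList (lref n).
Proof. case: G0 => Ts sz E; split; last exact: (simple_fsts n).
by rewrite -sz; apply: has_type_lref. Qed.

Lemma expr_isnil : exprG TBool (tIsNil (lref n)).
Proof.
have [? p] := expr_lref; split; first exact: HT_isnil.
by move: p; rewrite /all_subterms /= as_comp_lref => ->.
Qed.

Lemma expr_head : exprG (TProd TTag TData) (tHead (lref n)).
Proof.
have [? p] := expr_lref; split; first exact: HT_head.
by move: p; rewrite /all_subterms /= as_comp_lref => ->.
Qed.

Lemma expr_tail : exprG TList (tTail (lref n)).
Proof.
have [? p] := expr_lref; split; first exact: HT_tail.
by move: p; rewrite /all_subterms /= as_comp_lref => ->.
Qed.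

Lemma expr_fail : exprG TList (fail (lref n)).
Proof. by apply: expr_cons; [exact: expr_head | exact: expr_nil]. Qed.

Section Items.
Variables (V X : finType) (A : @access Sg disp D).
Hypothesis A_dd : forall v : V, exprG TBool (data_def A (rank v)).
Hypothesis A_dv : forall v : V, exprG TData (data_val A (rank v)).
Hypothesis A_sd : forall x : X, exprG TBool (str_def A (rank x)).
Hypothesis A_sv : forall x : X, exprG TList (str_val A (rank x)).
Implicit Types (s : seq (item Sg V X)) (phi : test V).

Lemma expr_items_def s : exprG TBool (items_def A (map (@raw_item _ _ _) s)).
Proof.
elim: s => [|i s IH] /=; first exact: expr_bool.
by apply: expr_and => //; case: i => [[c v]|x] /=.
Qed.

Lemma expr_items_val s : exprG TList (items_val A (map (@raw_item _ _ _) s)).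
Proof.
elim: s => [|i s IH] /=; first exact: expr_nil.
case: i => [[c v]|x] /=; last exact: expr_append.
by apply: expr_cons => //; apply: expr_pair => //; apply: expr_tag.
Qed.

Lemma expr_test_def phi : exprG TBool (test_def A (map_test (@rank V) phi)).
Proof.
elim: phi => [||v|v|p IHp|p IHp q IHq|p IHp q IHq] //=;
  by [apply: expr_bool | apply: expr_and].
Qed.

Lemma expr_test_val c phi :
  exprG TData c -> exprG TBool (test_val A c (map_test (@rank V) phi)).
Proof.
move=> Hc; elim: phi => [||v|v|p IHp|p IHp q IHq|p IHp q IHq] //=;
  try by [apply: expr_bool | apply: expr_and | apply: expr_isfalse | apply: expr_lt].
by apply: expr_if => //; apply: expr_bool.
Qed.

Lemma expr_out_term (o : option (seq (item Sg V X))) :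
  exprG TList (out_term A (lref n) (omap (map (@raw_item _ _ _)) o)).
Proof.
case: o => [s|] /=; last exact: expr_fail.
by apply: expr_if; [apply: expr_items_def | apply: expr_items_val | apply: expr_fail].
Qed.

End Items.
End Expr.
End Expressions.

(** * Ranks in finite sets *)

Lemma rank_lt (T : finType) (x : T) : rank x < card_of T.
Proof. exact: ltn_ord. Qed.

Lemma size_enum (T : finType) : size (enum T) = card_of T.
Proof. by rewrite -cardE. Qed.

Lemma rank_onto (T : finType) k : k < card_of T -> exists x : T, rank x = k.
Proof. by move=> ltk; exists (@enum_val T T (Ordinal ltk)); rewrite /rank enum_valK. Qed.

Lemma rank_inj (T : finType) : injective (@rank T).
Proof. by move=> x y /val_inj/enum_rank_inj. Qed.

Lemma map_rank (T : finType) : [seq rank x | x <- enum T] = iota 0 (card_of T).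
Proof.
apply: (@eq_from_nth _ 0); rewrite size_map size_enum ?size_iota // => i lti.
have [x <-] := rank_onto lti.
by rewrite (nth_map x) ?size_enum ?rank_lt // nth_enum_rank nth_iota ?rank_lt.
Qed.

Lemma Forall2_map_enum (T : finType) W Y Z (P : Y -> Z -> Prop)
    (g : T -> W) (f : W -> Y) y :
  (forall x, P (f (g x)) y) ->
  List.Forall2 P (map f (map g (enum T))) (nseq (card_of T) y).
Proof.
move=> H; rewrite -map_comp.
by apply: (@Forall2_map_nseq T _ _ P _ (enum T) _ y (esym (size_enum T))) => z _; apply: H.
Qed.

(** * Typing and shape of the compiled body *)

Section Compiled.
Context {Sg : finType} {disp : Order.disp_t} {D : orderType disp}.
Notation tm := (term Sg D).
Notation tbool b := (@tConst Sg D (CBool b)).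

Lemma has_type_init G Ts (init : seq tm) :
  List.Forall2 init_value Ts init -> List.Forall2 (has_type G) init Ts.
Proof.
elim=> [|U v Us vs Hv _ IH]; constructor => //.
move: Hv; rewrite /init_value; case: U => [|||| T U|T U] /=;
  try by case=> c -> <-; constructor.
by move=> ->; apply: HT_nil.
Qed.

(** The node condition yields at once that no let rebinds 0 or 1 (its names exceed 1), that no data
    constant, function or letrec occurs, and that only the input list is inspected. What remains
    specific to the body is its typing and the discipline of recursive calls. *)
Lemma single_pass_rec_fun Ts (b : tm) init :
  all (fun U => is_scalar U || is_list U) Ts ->
  (forall G, G 0 = Some (tprod TList Ts) -> G 1 = Some (TArr (tprod TList Ts) TList) ->
     has_type G b TList) ->
  all_subterms (body_node (size Ts)) b ->
  single_calls 0 1 Ts [::] (fun _ => [::]) b ->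
  List.Forall2 init_value Ts init ->
  single_pass [::] [::] (rec_fun Ts b init).
Proof.
move=> HTs Tb Nb SC Hi; exists Ts, 0, 1, 0, b, init => /=; split; first by [].
split.
  apply: HT_fun; apply: HT_letrec; first by apply: HT_fun; apply: Tb.
  apply: HT_app (tprod TList Ts) _ _ _ _ _; first exact: HT_var.
  apply: has_type_tuple; first exact: HT_var.
  exact: has_type_init.
split=> //; split; last split; last split=> //.
- split=> //; last by apply: all_subterms_sub Nb => -[] // [].
  + by apply: all_subterms_sub Nb => -[] //= y _ _; case: y => [|[]].
  + by apply: all_subterms_sub Nb => -[] //= y _ _; case: y => [|[]].
- by apply: all_subterms_sub Nb => -[] // [].
by apply: all_subterms_sub Nb => -[] // [].
Qed.

Lemma simple_body n (t : tm) :
  all_subterms (simple_node n) t -> all_subterms (body_node n) t.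
Proof. by apply: all_subterms_sub => -[]. Qed.

Lemma simple_free n (t : tm) : all_subterms (simple_node n) t -> free_of 1 t.
Proof. by apply: all_subterms_sub => -[]. Qed.

Variable S : sdst Sg Sg.
Notation R := (raw_of S).
Notation n := (nargs R).
Notation Q := (state S).
Notation V := (dvar S).
Notation X := (svar S).

Lemma nth_raw_out (q : Q) :
  nth None (raw_out R) (rank q) = omap (map (@raw_item Sg V X)) (out S q).
Proof. by rewrite [LHS](nth_map q) ?nth_enum_rank // size_enum rank_lt. Qed.

Lemma size_arg_types : size (arg_types R) = n.
Proof. by rewrite !size_cat !size_nseq. Qed.

Lemma nth_arg_types k : nth TBool (arg_types R) k =
  if k < card_of Q + card_of V then TBool
  else if k < card_of Q + (card_of V + card_of V) then TData
  else if k < card_of Q + (card_of V + (card_of V + card_of X)) then TBool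
  else if k < n then TList else TBool.
Proof.
rewrite /arg_types !nth_cat !size_nseq !nth_nseq /nargs /=.
by do ![case: ifP => ?] => //; lia.
Qed.

Definition list_offset := card_of Q + (card_of V + (card_of V + card_of X)).

(** Recovers the string variable behind a list argument; the copyless condition is a statement about
    that variable. *)
Lemma list_component k : is_list (nth TBool (arg_types R) k) ->
  exists x : X, k = list_offset + rank x.
Proof.
rewrite nth_arg_types; case: ifP => // _; case: ifP => // _; case: ifP => // ge.
case: ifP => // ltn _; have: k - list_offset < card_of X.
  by move: ltn ge; rewrite /list_offset /nargs /=; lia.
by move/rank_onto=> [x Ex]; exists x => //; rewrite Ex; move: ge; rewrite /list_offset; lia.
Qed.

Section Typing.
Variable G : nat -> option ty.
Hypothesis G0 : G 0 = Some (tprod TList (arg_types R)).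
Notation exprG := (@expr Sg disp D G n).

Let G0' : exists2 Ts, size Ts = n & G 0 = Some (tprod TList Ts).
Proof. by exists (arg_types R); rewrite ?size_arg_types. Qed.

Lemma expr_comp k : k < n -> exprG (nth TBool (arg_types R) k) (component n k).
Proof.
move=> ltk; split; last first.
  by have := simple_fsts (Sg := Sg) (D := D) n (n - k.+1); rewrite /all_subterms /= => ->.
by rewrite -size_arg_types; apply: has_type_comp; rewrite ?size_arg_types.
Qed.

Let kind (T : ty) k : k < n -> nth TBool (arg_types R) k = T -> exprG T (component n k).
Proof. by move=> ltk <-; apply: expr_comp. Qed.

Lemma expr_state (q : Q) : exprG TBool (component n (rank q)).
Proof.
have := rank_lt q => ltq; apply: kind; first by rewrite /nargs /=; lia.
by rewrite nth_arg_types ltn_addr.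
Qed.

Lemma expr_access0 :
  [/\ forall v : V, exprG TBool (data_def (access0 R) (rank v)),
      forall v : V, exprG TData (data_val (access0 R) (rank v)),
      forall x : X, exprG TBool (str_def (access0 R) (rank x))
    & forall x : X, exprG TList (str_val (access0 R) (rank x))].
Proof.
split=> z; have := rank_lt z => ltz; apply: kind;
  try (rewrite /nargs /=; lia); rewrite nth_arg_types /nargs /=;
  repeat (case: ifP => ?; try reflexivity); exfalso; lia.
Qed.

Hypothesis G3 : G 3 = Some (TProd TTag TData).

Let expr3 : exprG (TProd TTag TData) (tVar 3).
Proof. exact: expr_var. Qed.

Lemma expr_access1 :
  [/\ forall v : V, exprG TBool (data_def (access1 R) (rank v)),
      forall v : V, exprG TData (data_val (access1 R) (rank v)),
      forall x : X, exprG TBool (str_def (access1 R) (rank x))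
    & forall x : X, exprG TList (str_val (access1 R) (rank x))].
Proof.
case: expr_access0 => H1 H2 H3 H4; split=> // v /=; case: eqP => _;
  [exact: expr_bool | exact: H1 | exact: expr_snd expr3 | exact: H2].
Qed.

Lemma expr_enabled (t : transition Sg Sg Q V X) :
  exprG TBool (enabled_term R (raw_of_transition t)).
Proof.
case: expr_access1 => H1 H2 _ _.
apply: expr_and; first exact: expr_state.
apply: expr_and; first by apply: expr_istag; apply: expr_fst expr3.
apply: expr_and; first exact: expr_test_def.
by apply: expr_test_val => //; apply: expr_snd expr3.
Qed.

Notation typed_args := (List.Forall2 (fun t T => exprG T t)).

Lemma expr_state_flags k : typed_args (state_flags R k) (nseq (card_of Q) TBool).
Proof. by apply: Forall2_map_nseq; [rewrite size_iota | move=> *; apply: expr_bool]. Qed.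

Lemma expr_trans_args (t : transition Sg Sg Q V X) :
  typed_args (trans_args R (raw_of_transition t)) (arg_types R).
Proof.
case: expr_access1 => H1 H2 H3 H4.
apply: List.Forall2_app; first exact: expr_state_flags.
do ?[apply: List.Forall2_app]; apply: Forall2_map_enum => z //.
  exact: expr_items_def.
exact: expr_items_val.
Qed.

Lemma expr_dead_args : typed_args (dead_args R) (arg_types R).
Proof.
apply: List.Forall2_app; first exact: expr_state_flags.
do ?[apply: List.Forall2_app]; apply: Forall2_nseq; try exact: expr_bool.
  exact: expr_snd expr3.
exact: expr_nil.
Qed.

Lemma has_type_call args :
  G 1 = Some (TArr (tprod TList (arg_types R)) TList) ->
  typed_args args (arg_types R) -> has_type G (call R args) TList.
Proof.
move=> G1 Ha; apply: HT_let TList _ _ _ _ _; last exact: HT_var.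
apply: (HT_app (HT_var G1)); apply: has_type_tuple; first exact: (proj1 (expr_tail G0')).
by elim: Ha => // t T ts Ts [? _]; constructor.
Qed.

Lemma call_body_node args : typed_args args (arg_types R) ->
  all_subterms (body_node n) (call R args).
Proof.
move=> Ha; rewrite /all_subterms /= !andbT.
(* [tm_tuple] is a left fold, so the induction needs an arbitrary first component. *)
suff H t : all_subterms (body_node n) t ->
  all_subterms (body_node n) (tm_tuple t args).
  by apply: H; apply: simple_body; apply: (proj2 (expr_tail G0')).
elim: Ha t => //= u T ts Ts [_ /simple_body Hu] _ IH t Ht.
by apply: IH; move: Ht Hu; rewrite /all_subterms /= => -> ->.
Qed.

Lemma trans_terms_typed : 
  G 1 = Some (TArr (tprod TList (arg_types R)) TList) ->
  has_type G (trans_terms R : tm) TList /\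
  all_subterms (body_node n) (trans_terms R : tm).
Proof.
move=> G1; rewrite /trans_terms /=; elim: (trans S) => [|t ts [IH1 IH2]] /=.
  by split; [apply: has_type_call => // | apply: call_body_node]; apply: expr_dead_args.
have [T1 /simple_body T2] := expr_enabled t; have Ha := expr_trans_args t.
split; first by apply: HT_if => //; apply: has_type_call.
by move: T2 IH2 (call_body_node Ha); rewrite /all_subterms /= => -> -> ->.
Qed.

End Typing.

Lemma expr_out_terms G : G 0 = Some (tprod TList (arg_types R)) ->
  expr G n TList (out_terms R : tm).
Proof.
move=> G0; have G0' : exists2 Ts, size Ts = n & G 0 = Some (tprod TList Ts).
  by exists (arg_types R); rewrite ?size_arg_types.
case: (expr_access0 G0) => H1 H2 H3 H4.
rewrite /out_terms -map_rank; elim: (enum Q) => [|q qs IH] /=; first exact: expr_fail.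
apply: expr_if => //; first exact: expr_state.
by rewrite nth_raw_out; apply: expr_out_term.
Qed.

Lemma body_typed G : G 0 = Some (tprod TList (arg_types R)) ->
  G 1 = Some (TArr (tprod TList (arg_types R)) TList) ->
  has_type G (body R : tm) TList /\ all_subterms (body_node n) (body R : tm).
Proof.
move=> G0 G1; have G0' : exists2 Ts, size Ts = n & G 0 = Some (tprod TList Ts).
  by exists (arg_types R); rewrite ?size_arg_types.
have [T1 /simple_body N1] := expr_out_terms G0.
have [T2 N2] := @trans_terms_typed (upd G 3 (Some (TProd TTag TData))) G0 erefl G1.
have [T3 /simple_body N3] := expr_isnil (D := D) (Sg := Sg) G0'.
have [T4 /simple_body N4] := expr_head (D := D) (Sg := Sg) G0'.
split; first by apply: HT_if => //; apply: HT_let T4 T2.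
by move: N1 N2 N3 N4; rewrite /all_subterms /= => -> -> -> _.
Qed.

End Compiled.

(** * Copyless use of the list arguments *)

Section Copyless.
Context {Sg : finType} {disp : Order.disp_t} {D : orderType disp}.
Notation tm := (term Sg D).

Section Components.
Variables (n : nat) (rho : nat -> seq nat).
Hypothesis rho0 : forall y, rho y = [::].
Notation comps := (@comps_in Sg disp D 0 n rho).

Lemma comps_if t u v : comps (tIf t u v) = comps t ++ comps u ++ comps v.
Proof. by rewrite /comps_in /collect /= cats0. Qed.

Lemma comps_cons t u : comps (tCons t u) = comps t ++ comps u.
Proof. by rewrite /comps_in /collect /= cats0. Qed.

Lemma comps_append t u : comps (tAppend t u) = comps t ++ comps u.
Proof. by rewrite /comps_in /collect /= cats0. Qed.

Lemma comps_pair t u : comps (tPair t u) = comps t ++ comps u.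
Proof. by rewrite /comps_in /collect /= cats0. Qed.

Lemma comps_var y : y != 0 -> comps (tVar y) = [::].
Proof. by rewrite /comps_in /collect /= /comp_leaf /= => /negPf -> /=; rewrite rho0. Qed.

Lemma comps_snd3 : comps (tSnd (tVar 3)) = [::].
Proof. by rewrite /comps_in /collect /= rho0. Qed.

Lemma comps_comp k : k < n -> comps (component n k) = [:: k.+1].
Proof.
move=> ltk; have := as_comp_comp (Sg := Sg) (D := D) ltk.
by rewrite /comps_in /collect /comp_leaf /component /= => ->.
Qed.

Section Items.
Variables (V X : finType) (A : @access Sg disp D) (k : nat).
Implicit Types s : seq (item Sg V X).
Hypothesis A_dd : forall v : V, k \notin comps (data_def A (rank v)).
Hypothesis A_dv : forall v : V, k \notin comps (data_val A (rank v)).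
Hypothesis A_sd : forall x : X, k \notin comps (str_def A (rank x)).

Lemma comps_items_def s : k \notin comps (items_def A (map (@raw_item _ _ _) s)).
Proof.
elim: s => // i s IH /=; rewrite comps_if !mem_cat !negb_or IH /= andbT.
by case: i => [cv|x] /=.
Qed.

(** A letter contributes a tag and a data value, which do not use component [k]; so [k] can only
    come from a string variable of [s]. *)
Lemma comps_items_val s : k \in comps (items_val A (map (@raw_item _ _ _) s)) ->
  exists2 x : X, List.In (inr x) s & k \in comps (str_val A (rank x)).
Proof.
elim: s => // i s IH /=; case: i => [cv|x] /=.
  rewrite comps_cons comps_pair !mem_cat (negPf (A_dv _)) orbF /= => /IH [x xs kx].
  by exists x => //; right.
rewrite comps_append mem_cat => /orP[kx|/IH [y ys ky]]; first by exists x => //; left.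
by exists y => //; right.
Qed.

End Items.
End Components.

Variable S : sdst Sg Sg.
Notation R := (raw_of S).
Notation n := (nargs R).
Notation V := (dvar S).
Notation X := (svar S).

Section Access.
Variables (rho : nat -> seq nat) (rho0 : forall y, rho y = [::]) (k : nat).
Hypothesis k_list : is_list (nth TBool (TList :: arg_types R) k).
Notation comps := (@comps_in Sg disp D 0 n rho).
Notation A := (access1 R).

(** A list component is either 0, the input list, or lies past all scalar blocks. Flags and data
    values are constants, scalar components or, for [curr], the let-bound head, so only the value of
    a string variable can use it. *)
Lemma comps_access1 :
  [/\ forall v : V, k \notin comps (data_def A (rank v)),
      forall v : V, k \notin comps (data_val A (rank v)),
      forall x : X, k \notin comps (str_def A (rank x))
    & forall x : X, k \in comps (str_val A (rank x)) -> k = (list_offset S + rank x).+1].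
Proof.
have off : k = 0 \/ list_offset S < k.
  by case: k k_list => [|j]; [left | move=> /list_component [x ->]; right; lia].
move: off; rewrite /list_offset => off.
split=> z; have ltz := rank_lt z; rewrite /=; try case: eqP => _ //;
  rewrite ?comps_snd3 // comps_comp ?inE; try (by rewrite /nargs /=; lia).
Qed.

(** If [k] is 0 no argument uses it. Otherwise it holds some string variable [x], and the argument
    for [y] can use it only when [x] occurs in the string assigned to [y], so the copyless condition
    on the transition bounds the number of uses. *)
Lemma trans_args_copyless (t : transition Sg Sg (state S) V X) :
  (forall x, \sum_(y : X) count (is_svar x) (asgn_str t y) <= 1) ->
  count (fun e => k \in comps e) (trans_args R (raw_of_transition t)) <= 1.
Proof.
move=> cl; case: comps_access1 => H1 H2 H3 H4.
have count0 W (f : W -> tm) (g : V -> W) :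
    (forall v, k \notin comps (f (g v))) ->
    count (fun e => k \in comps e) (map f (map g (enum V))) = 0.
  move=> H; rewrite -map_comp count_map.
  by elim: (enum V) => //= v s ->; rewrite (negPf (H v)).
pose raw_t := raw_of_transition t.
have e0 : count (fun e => k \in comps e) (state_flags R (raw_dst raw_t)) = 0.
  by rewrite /state_flags count_map; elim: (iota _ _).
have e1 : count (fun e => k \in comps e) (map (data_def A) (raw_data raw_t)) = 0.
  by apply: count0 => v; apply: H1.
have e2 : count (fun e => k \in comps e) (map (data_val A) (raw_data raw_t)) = 0.
  by apply: count0 => v; apply: H2.
have e3 : count (fun e => k \in comps e) (map (items_def A) (raw_str raw_t)) = 0.
  rewrite -map_comp count_map; elim: (enum X) => //= x s ->.
  by rewrite (negPf (comps_items_def H1 H3 _)).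
rewrite /trans_args !count_cat e0 e1 e2 e3 !add0n -map_comp count_map.
case: (pickP (fun x : X => k == (list_offset S + rank x).+1)) => [x /eqP Ek|no]; last first.
  rewrite (eq_count (a2 := pred0)) ?count_pred0 // => y /=; apply/negbTE/negP.
  by move/(comps_items_val H2) => [x _ /H4 Ek]; move: (no x); rewrite Ek eqxx.
(* The sums are compared term by term: an argument that uses [k] comes from a string with at least
   one occurrence of [x]. *)
apply: leq_trans (cl x); rewrite -sum1_count big_mkcond /= big_enum /=.
apply: leq_sum => y _; case: ifP => // /(comps_items_val H2) [z zs /H4].
rewrite Ek => -[] /addnI /rank_inj exz; subst z.
elim: (asgn_str t y) zs => //= i s IH [-> /=|/IH]; first by rewrite eqxx.
by move=> le; apply: leq_trans le (leq_addl _ _).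
Qed.

Lemma dead_args_copyless : count (fun e => k \in comps e) (dead_args R) = 0.
Proof.
rewrite /dead_args !count_cat /state_flags count_map !count_nseq /= comps_snd3 //=.
by rewrite -map_rank; elim: (enum _).
Qed.

End Access.

(** The returned term is the name bound to the recursive result, which carries no component of the
    argument tuple; all uses of lists are in the arguments. *)
Lemma single_calls_call rho args : (forall y, rho y = [::]) ->
  List.Forall2 (fun t T => all_subterms (simple_node n) t) args (arg_types R) ->
  (forall k, is_list (nth TBool (TList :: arg_types R) k) ->
     count (fun e => k \in @comps_in Sg disp D 0 n rho e) args <= 1) ->
  single_calls 0 1 (arg_types R) [::] rho (call R args).
Proof.
move=> rho0 Ha cl.
have sz : size args = size (arg_types R) by elim: Ha => //= t T ts Ts _ _ ->.
apply: (@SC_call _ _ _ 0 1 (arg_types R) [::] rho 2 (lref n) args (tVar 2) [::]) => //.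
- by rewrite size_arg_types as_comp_lref.
- by elim: Ha => //= t T ts Ts /simple_free -> _ ->.
- by split=> // k; rewrite /comps_used /collect /= inE.
have upd0 y : upd rho 2 [::] y = [::] by rewrite /upd; case: eqP.
move=> k _ klist; rewrite size_arg_types.
have -> : count (fun e => k \in @comps_in Sg disp D 0 n (upd rho 2 [::]) e) [:: tVar 2] = 0.
  by rewrite /count comps_var.
by rewrite addn0; apply: cl.
Qed.

Lemma single_calls_body :
  (forall t, List.In t (trans S) ->
     forall x, \sum_(y : X) count (is_svar x) (asgn_str t y) <= 1) ->
  single_calls 0 1 (arg_types R) [::] (fun _ => [::]) (body R : tm).
Proof.
move=> cl.
(* A context with the right types at 0 and 3 gives access to [expr], of which the syntactic half is
   wanted here. *)
pose G := upd (fun i : nat => if i == 0 then Some (tprod TList (arg_types R)) else None)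
            3 (Some (TProd TTag TData)).
have G0 : G 0 = Some (tprod TList (arg_types R)) by [].
have G3 : G 3 = Some (TProd TTag TData) by [].
have G0' : exists2 Ts, size Ts = n & G 0 = Some (tprod TList Ts).
  by exists (arg_types R); rewrite ?size_arg_types.
apply: SC_if; first exact: simple_free (proj2 (expr_isnil G0')).
  apply: SC_plain; exact: simple_free (proj2 (expr_out_terms G0)).
apply: SC_let; first exact: simple_free (proj2 (expr_head G0')).
set rho := upd _ _ _.
(* The head of a list contains no list, so the let-bound name 3 carries no component. *)
have rho0 y : rho y = [::] by rewrite /rho /upd; case: eqP.
have simple args : List.Forall2 (fun (t : tm) T => expr G n T t) args (arg_types R) ->
    List.Forall2 (fun (t : tm) _ => all_subterms (simple_node n) t) args (arg_types R).
  by elim=> // t T ts Ts [_ ?]; constructor.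
rewrite /trans_terms /=; elim: (trans S) cl => [|t ts IH] cl /=.
  apply: single_calls_call => //; first exact/simple/expr_dead_args.
  by move=> k _; rewrite dead_args_copyless.
apply: SC_if; first exact: simple_free (proj2 (expr_enabled G0 G3 t)).
  apply: single_calls_call => //; first exact/simple/expr_trans_args.
  by move=> k klist; apply: trans_args_copyless => //; apply: cl; left.
by apply: IH => u uts; apply: cl; right.
Qed.

End Copyless.

(** * Evaluation *)

Section Evaluation.
Context {Sg : finType} {disp : Order.disp_t} {D : orderType disp}.
Notation tm := (term Sg D).
Notation tbool b := (@tConst Sg D (CBool b)).
Notation tdata d := (@tConst Sg D (CData d)).
Implicit Types t u v w : tm.

(** A reduction function containing [step], from which determinism is read off. It often asks for
    normal forms where [step] asks for values, so it may reduce more; this is harmless, since a term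
    on which it is undefined has no [step] either. The let case does ask for a value, so that a let
    over a stuck term is stuck. *)
Fixpoint stepf t : option tm :=
  match t with
  | tVar _ | tConst _ | tNil | tFun _ _ _ => None
  | tIsTrue u =>
      if stepf u is Some u' then Some (tIsTrue u')
      else if u is tConst (CBool b) then Some (tbool b) else None
  | tIsFalse u =>
      if stepf u is Some u' then Some (tIsFalse u')
      else if u is tConst (CBool b) then Some (tbool (~~ b)) else None
  | tIsTag s u =>
      if stepf u is Some u' then Some (tIsTag s u')
      else if u is tConst (CTag s') then Some (tbool (s' == s)) else None
  | tApp u w =>
      if stepf u is Some u' then Some (tApp u' w)
      else if stepf w is Some w' then Some (tApp u w')
      else if u is tFun x _ b then Some (subst x w b) else None
  | tIf c u w =>
      if stepf c is Some c' then Some (tIf c' u w)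
      else if c is tConst (CBool b) then Some (if b then u else w) else None
  | tEq u w =>
      if stepf u is Some u' then Some (tEq u' w)
      else if stepf w is Some w' then Some (tEq u w')
      else if (u, w) is (tConst (CData d), tConst (CData e)) then Some (tbool (d == e))
      else None
  | tLt u w =>
      if stepf u is Some u' then Some (tLt u' w)
      else if stepf w is Some w' then Some (tLt u w')
      else if (u, w) is (tConst (CData d), tConst (CData e)) then Some (tbool (d < e)%O)
      else None
  | tPair u w =>
      if stepf u is Some u' then Some (tPair u' w)
      else if stepf w is Some w' then Some (tPair u w') else None
  | tFst u =>
      if stepf u is Some u' then Some (tFst u')
      else if u is tPair a _ then Some a else None
  | tSnd u =>
      if stepf u is Some u' then Some (tSnd u')
      else if u is tPair _ b then Some b else None
  | tCons u w =>
      if stepf u is Some u' then Some (tCons u' w)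
      else if stepf w is Some w' then Some (tCons u w') else None
  | tAppend u w =>
      if stepf u is Some u' then Some (tAppend u' w)
      else if stepf w is Some w' then Some (tAppend u w')
      else match u with
           | tNil => Some w
           | tCons a b => Some (tCons a (tAppend b w))
           | _ => None
           end
  | tIsNil u =>
      if stepf u is Some u' then Some (tIsNil u')
      else match u with
           | tNil => Some (tbool true)
           | tCons _ _ => Some (tbool false)
           | _ => None
           end
  | tHead u =>
      if stepf u is Some u' then Some (tHead u')
      else if u is tCons a _ then Some a else None
  | tTail u =>
      if stepf u is Some u' then Some (tTail u')
      else if u is tCons _ b then Some b else None
  | tLet x u w =>
      if stepf u is Some u' then Some (tLet x u' w)
      else if is_value u then Some (subst x u w) else None
  | tLetrec x T u w => Some (subst x (tLetrec x T u u) w)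
  end.

Lemma stepf_value v : is_value v -> stepf v = None.
Proof.
by elim: v => //= u IHu w IHw /andP[/IHu -> /IHw ->].
Qed.

Lemma stepf_step t u : step t u -> stepf t = Some u.
Proof.
elim=> {t u} [t u|F t u ok _ IH].
  by case=> /= *; rewrite ?stepf_value //= ifT.
case: F ok => //= *; rewrite ?IH ?stepf_value //=; by rewrite IH.
Qed.

Definition stuck t : Prop := stepf t = None /\ ~~ is_value t.

Lemma steps_nf t u u' :
  steps t u -> steps t u' -> stepf u = None -> stepf u' = None -> u = u'.
Proof.
move=> tu; elim: tu u' => {t u} [t|t u w tu _ IH] u'.
  case=> [//|x y /stepf_step E _ nf _]; by rewrite nf in E.
move=> tu' nf nf'; case: tu' tu nf' => [/stepf_step -> //|x y tx xy].
by move: tx => /stepf_step E /stepf_step; rewrite E => -[exu] nf'; subst; apply: IH.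
Qed.

Lemma steps_refl t : steps t t.
Proof. exact: Relation_Operators.rt1n_refl. Qed.

Lemma steps_red t u v : red t u -> steps u v -> steps t v.
Proof. by move=> /Step_red tu uv; apply: Relation_Operators.rt1n_trans tu uv. Qed.

Lemma steps_trans t u v : steps t u -> steps u v -> steps t v.
Proof.
elim=> // {t u} t u w tu _ IH wv; apply: Relation_Operators.rt1n_trans tu (IH wv).
Qed.

Lemma steps_frame F t u : frame_ok F -> steps t u -> steps (plug F t) (plug F u).
Proof.
move=> ok; elim=> {t u} [t|t u w tu _ IH]; first exact: steps_refl.
by apply: Relation_Operators.rt1n_trans (Step_frame ok tu) IH.
Qed.

Lemma list_term_value (l : seq (Sg * D)) : is_value (list_term l).
Proof. by elim: l => //= -[]. Qed.

Lemma list_term_inj : injective (@list_term Sg disp D).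
Proof. by elim=> [|[s d] l IH] [|[s' d'] l'] //= [-> -> /IH ->]. Qed.

Lemma steps_if c t u (b : bool) v :
  steps c (tbool b) -> steps (if b then t else u) v -> steps (tIf c t u) v.
Proof.
move=> /(steps_frame (F := F_if t u) isT) Hc Hv; apply: steps_trans Hc _.
by case: b Hv => Hv; apply: steps_red Hv; constructor.
Qed.

Lemma steps_and t u (b c : bool) :
  steps t (tbool b) -> steps u (tbool c) -> steps (tand t u) (tbool (b && c)).
Proof. by move=> Ht Hu; apply: steps_if Ht _; case: b => //; apply: steps_refl. Qed.

Lemma steps_isfalse t b : steps t (tbool b) -> steps (tIsFalse t) (tbool (~~ b)).
Proof.
move=> /(steps_frame (F := F_isfalse) isT) H; apply: steps_trans H _.
by apply: steps_red (steps_refl _); constructor.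
Qed.

Lemma steps_istag s s' t :
  steps t (tConst (CTag s')) -> steps (tIsTag s t) (tbool (s' == s)).
Proof.
move=> /(steps_frame (F := F_istag s) isT) H; apply: steps_trans H _.
by apply: steps_red (steps_refl _); constructor.
Qed.

Lemma steps_lt t u d e :
  steps t (tdata d) -> steps u (tdata e) -> steps (tLt t u) (tbool (d < e)%O).
Proof.
move=> /(steps_frame (F := F_ltl u) isT) Ht /(steps_frame (F := F_ltr (tdata d)) isT) Hu.
apply: steps_trans Ht _; apply: steps_trans Hu _.
by apply: steps_red (steps_refl _); constructor.
Qed.

Lemma steps_pair t u v w : is_value v ->
  steps t v -> steps u w -> steps (tPair t u) (tPair v w).
Proof.
move=> Hv /(steps_frame (F := F_pairl u) isT) Ht /(steps_frame (F := F_pairr v) Hv).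
exact: steps_trans.
Qed.

Lemma steps_cons t u v w : is_value v ->
  steps t v -> steps u w -> steps (tCons t u) (tCons v w).
Proof.
move=> Hv /(steps_frame (F := F_consl u) isT) Ht /(steps_frame (F := F_consr v) Hv).
exact: steps_trans.
Qed.

Lemma steps_append t u (l m : seq (Sg * D)) :
  steps t (list_term l) -> steps u (list_term m) ->
  steps (tAppend t u) (list_term (l ++ m)).
Proof.
move=> /(steps_frame (F := F_appendl u) isT) Ht
  /(steps_frame (F := F_appendr (list_term l)) (list_term_value l)) Hu.
apply: steps_trans Ht _; apply: steps_trans Hu _ => /=.
elim: l => [|[s d] l IH] /=.
  by apply: steps_red (steps_refl _); constructor; apply: list_term_value.
apply: steps_red; first by constructor; rewrite ?list_term_value.
exact: steps_cons (steps_refl _) IH.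
Qed.

Lemma steps_fst t v w : is_value v -> is_value w ->
  steps t (tPair v w) -> steps (tFst t) v.
Proof.
move=> Hv Hw /(steps_frame (F := F_fst) isT) H; apply: steps_trans H _.
by apply: steps_red (steps_refl _); constructor.
Qed.

Lemma steps_snd t v w : is_value v -> is_value w ->
  steps t (tPair v w) -> steps (tSnd t) w.
Proof.
move=> Hv Hw /(steps_frame (F := F_snd) isT) H; apply: steps_trans H _.
by apply: steps_red (steps_refl _); constructor.
Qed.

Lemma steps_isnil t (l : seq (Sg * D)) :
  steps t (list_term l) -> steps (tIsNil t) (tbool (nilp l)).
Proof.
move=> /(steps_frame (F := F_isnil) isT) H; apply: steps_trans H _.
by case: l => [|[s d] l] /=; apply: steps_red (steps_refl _); constructor;
  rewrite ?list_term_value.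
Qed.

Lemma steps_head t s d (l : seq (Sg * D)) : steps t (list_term ((s, d) :: l)) ->
  steps (tHead t) (tPair (tConst (CTag s)) (tdata d)).
Proof.
move=> /(steps_frame (F := F_head) isT) H; apply: steps_trans H _.
by apply: steps_red (steps_refl _); constructor; rewrite ?list_term_value.
Qed.

Lemma steps_tail t a (l : seq (Sg * D)) : steps t (list_term (a :: l)) ->
  steps (tTail t) (list_term l).
Proof.
move=> /(steps_frame (F := F_tail) isT) H; apply: steps_trans H _.
by case: a => s d; apply: steps_red (steps_refl _); constructor; rewrite ?list_term_value.
Qed.

Lemma tm_tuple_value v vs :
  is_value v -> all is_value vs -> is_value (tm_tuple v vs).
Proof.
elim: vs v => //= w ws IH v Hv /andP[Hw Hws].
by apply: IH => //=; rewrite Hv.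
Qed.

Lemma steps_tuple t v ts vs : is_value v -> all is_value vs ->
  steps t v -> List.Forall2 steps ts vs -> steps (tm_tuple t ts) (tm_tuple v vs).
Proof.
move=> Hv Hvs tv H; elim: H t v Hv Hvs tv => //= u w us ws uw _ IH t v Hv /andP[Hw Hws] tv.
by apply: IH => //=; [rewrite Hv | apply: steps_pair].
Qed.

(** Failure is witnessed positively, by a reachable stuck term: as normal forms are unique, this
    excludes every list result. *)
Definition behaves t (o : option (seq (Sg * D))) : Prop :=
  if o is Some l then steps t (list_term l) else exists2 u, steps t u & stuck u.

Lemma behaves_steps t u o : steps t u -> behaves u o -> behaves t o.
Proof.
move=> tu; case: o => [l|] /=; first exact: steps_trans.
by move=> [w uw Hw]; exists w => //; apply: steps_trans uw.
Qed.

Lemma behaves_if c t u (b : bool) o :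
  steps c (tbool b) -> behaves (if b then t else u) o -> behaves (tIf c t u) o.
Proof. by move=> Hc; apply: behaves_steps; apply: steps_if Hc (steps_refl _). Qed.

(** A let evaluates its bound term first, so it is stuck once that term is. Through this, a failure
    at the end of the input propagates back through all pending calls. *)
Lemma behaves_let x t o : behaves t o -> behaves (tLet x t (tVar x)) o.
Proof.
case: o => [l|] /=.
  move=> /(steps_frame (F := F_let x (tVar x)) isT) H; apply: steps_trans H _.
  apply: steps_red; first by constructor; apply: list_term_value.
  by rewrite /= eqxx; apply: steps_refl.
move=> [u tu [nf nv]]; exists (tLet x u (tVar x)).
  exact: (steps_frame (F := F_let x (tVar x)) isT).
by split=> //=; rewrite nf (negPf nv).
Qed.

End Evaluation.

(** * Pending substitutions and projections of tuples *)

Section Substitution.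
Context {Sg : finType} {disp : Order.disp_t} {D : orderType disp}.
Notation tm := (term Sg D).
Notation tbool b := (@tConst Sg D (CBool b)).
Notation tdata d := (@tConst Sg D (CData d)).

(** A variable free in a typed term has a type in its context. This gets closedness of the recursive
    function from its typing. *)
Lemma subst_closed G (t : tm) T y (s : tm) :
  has_type G t T -> G y = None -> subst y s t = t.
Proof.
elim=> {G t T} //=; try by move=> *; repeat match goal with
  H : _ -> subst _ _ _ = _ |- _ => rewrite H //; clear H end.
- by move=> G x T Gx Gy; case: eqP => // E; rewrite -E Gx in Gy.
- move=> G x T U t _ IH Gy; case: eqP => // /eqP ne.
  by rewrite IH // /upd eq_sym (negPf ne).
- move=> G x T U t u _ IHt _ IHu Gy; rewrite IHt //; case: eqP => // /eqP ne.
  by rewrite IHu // /upd eq_sym (negPf ne).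
- move=> G x T U t u _ IHt _ IHu Gy; case: eqP => // /eqP ne.
  by rewrite IHt ?IHu // /upd eq_sym (negPf ne).
Qed.

Lemma subst_list_term y (s : tm) (l : seq (Sg * D)) :
  subst y s (list_term l) = list_term l.
Proof. by elim: l => //= -[c d] l /= ->. Qed.

Lemma subst_tm_tuple y (s t : tm) ts :
  subst y s (tm_tuple t ts) = tm_tuple (subst y s t) (map (subst y s) ts).
Proof. by elim: ts t => //= u us IH t; rewrite IH. Qed.

(** The substitutions made by evaluation, applied from left to right. They are kept pending in front
    of compiled terms, which retain their shape, so that evaluation can be studied by induction on
    the item or test compiled. *)
Definition substs (ss : seq (nat * tm)) (t : tm) : tm :=
  foldl (fun t p => subst p.1 p.2 t) t ss.

Variable ss : seq (nat * tm).
Implicit Types t u v : tm.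

Lemma substs_const c : substs ss (tConst c) = tConst c.
Proof. by elim: ss. Qed.

Lemma substs_nil : substs ss tNil = tNil.
Proof. by elim: ss. Qed.

Lemma substs_if t u v : substs ss (tIf t u v) = tIf (substs ss t) (substs ss u) (substs ss v).
Proof. by elim: ss t u v => /=. Qed.

Lemma substs_isfalse t : substs ss (tIsFalse t) = tIsFalse (substs ss t).
Proof. by elim: ss t => /=. Qed.

Lemma substs_istag c t : substs ss (tIsTag c t) = tIsTag c (substs ss t).
Proof. by elim: ss t => /=. Qed.

Lemma substs_app t u : substs ss (tApp t u) = tApp (substs ss t) (substs ss u).
Proof. by elim: ss t u => /=. Qed.

Lemma substs_lt t u : substs ss (tLt t u) = tLt (substs ss t) (substs ss u).
Proof. by elim: ss t u => /=. Qed.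

Lemma substs_pair t u : substs ss (tPair t u) = tPair (substs ss t) (substs ss u).
Proof. by elim: ss t u => /=. Qed.

Lemma substs_cons t u : substs ss (tCons t u) = tCons (substs ss t) (substs ss u).
Proof. by elim: ss t u => /=. Qed.

Lemma substs_append t u : substs ss (tAppend t u) = tAppend (substs ss t) (substs ss u).
Proof. by elim: ss t u => /=. Qed.

Lemma substs_fst t : substs ss (tFst t) = tFst (substs ss t).
Proof. by elim: ss t => /=. Qed.

Lemma substs_snd t : substs ss (tSnd t) = tSnd (substs ss t).
Proof. by elim: ss t => /=. Qed.

Lemma substs_isnil t : substs ss (tIsNil t) = tIsNil (substs ss t).
Proof. by elim: ss t => /=. Qed.

Lemma substs_head t : substs ss (tHead t) = tHead (substs ss t).
Proof. by elim: ss t => /=. Qed.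

Lemma substs_tail t : substs ss (tTail t) = tTail (substs ss t).
Proof. by elim: ss t => /=. Qed.

Lemma substs_let y t u : all (fun p => p.1 != y) ss ->
  substs ss (tLet y t u) = tLet y (substs ss t) (substs ss u).
Proof.
by elim: ss t u => //= p r IH t u /andP[/negPf E /IH {}IH]; rewrite eq_sym E IH.
Qed.

Lemma substs_tuple t ts :
  substs ss (tm_tuple t ts) = tm_tuple (substs ss t) (map (substs ss) ts).
Proof. by elim: ts t => //= u us IH t; rewrite IH substs_pair. Qed.

Lemma all_take (p : pred tm) k r : all p r -> all p (take k r).
Proof. by rewrite -{1}(cat_take_drop k r) all_cat => /andP[]. Qed.

(** Tuples are nested to the left, so each first projection removes the last component. *)
Lemma steps_fsts j v vs : is_value v -> all is_value vs -> j <= size vs ->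
  steps (iter j (@tFst Sg D) (tm_tuple v vs)) (tm_tuple v (take (size vs - j) vs)).
Proof.
move=> Hv Hvs; elim: j => [|j IH] ltj.
  by rewrite subn0 take_size; apply: steps_refl.
have lt : size vs - j.+1 < size vs by lia.
have := IH (ltnW ltj); rewrite (_ : size vs - j = (size vs - j.+1).+1); last lia.
rewrite (take_nth tNil lt) /tm_tuple foldl_rcons => H.
apply: steps_fst H; last exact: all_nthP.
by apply: tm_tuple_value => //; apply: all_take.
Qed.

Section Components.
Variables (v : tm) (vs : seq tm).
Hypothesis Hv : is_value v.
Hypothesis Hvs : all is_value vs.
Hypothesis var0 : substs ss (tVar 0) = tm_tuple v vs.

Lemma substs_fsts j :
  substs ss (iter j (@tFst Sg D) (tVar 0)) = iter j (@tFst Sg D) (tm_tuple v vs).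
Proof. by elim: j => //= j IH; rewrite substs_fst IH. Qed.

Lemma steps_lref : steps (substs ss (lref (size vs))) v.
Proof. by have := steps_fsts Hv Hvs (leqnn _); rewrite /lref substs_fsts subnn take0. Qed.

Lemma steps_comp k : k < size vs -> steps (substs ss (component (size vs) k)) (nth tNil vs k).
Proof.
move=> ltk; rewrite /component substs_snd substs_fsts.
have := steps_fsts Hv Hvs (leq_subr k.+1 _); rewrite subKn //.
rewrite (take_nth tNil ltk) /tm_tuple foldl_rcons => H.
apply: steps_snd H; last exact: all_nthP.
by apply: tm_tuple_value => //; apply: all_take.
Qed.

End Components.

End Substitution.

Arguments substs : simpl never.

(* A valuation made total: whether each variable is defined, and its value. *)
Record memory (Sg : finType) (D : Type) (V X : Type) := Memory {
  mem_dd : V -> bool;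
  mem_dv : V -> D;
  mem_sd : X -> bool;
  mem_sv : X -> seq (Sg * D)
}.

(** * Definedness and values of tests and strings *)

Section Memory.
Context {Sg : finType} {disp : Order.disp_t} {D : orderType disp}.
Context {V X : finType}.
Notation tm := (term Sg D).
Notation tbool b := (@tConst Sg D (CBool b)).
Notation tdata d := (@tConst Sg D (CData d)).
Implicit Types (s : seq (item Sg V X)) (phi : test V) (m : memory Sg D V X).

Definition items_defined m s : bool :=
  all (fun i => match i with inl cv => mem_dd m cv.2 | inr x => mem_sd m x end) s.

Definition items_value m s : seq (Sg * D) :=
  flatten [seq match i with inl cv => [:: (cv.1, mem_dv m cv.2)] | inr x => mem_sv m x end
          | i <- s].

Fixpoint test_defined m phi : bool :=
  match phi with
  | Btrue | Bfalse => true
  | Blt_curr v | Bcurr_lt v => mem_dd m v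
  | Bnot p => test_defined m p
  | Band p q | Bor p q => test_defined m p && test_defined m q
  end.

Fixpoint test_value m (d : D) phi : bool :=
  match phi with
  | Btrue => true
  | Bfalse => false
  | Blt_curr v => (mem_dv m v < d)%O
  | Bcurr_lt v => (d < mem_dv m v)%O
  | Bnot p => ~~ test_value m d p
  | Band p q => test_value m d p && test_value m d q
  | Bor p q => test_value m d p || test_value m d q
  end.

Definition represents (b : V -> option D) (m : memory Sg D V X) : Prop :=
  forall v, b v = if mem_dd m v then Some (mem_dv m v) else None.

(** The partial semantics is strict in both sides of every connective, so definedness is a
    conjunction over the variables of the test, and can be computed apart from the value. *)
Lemma eval_test_represents b m cur d phi : represents b m -> b cur = Some d ->
  eval_test cur b phi = if test_defined m phi then Some (test_value m d phi) else None.
Proof.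
move=> bm bc; elim: phi => //= [v|v|p ->|p -> q ->|p -> q ->]; rewrite ?bc ?bm.
- by case: (mem_dd m v).
- by case: (mem_dd m v).
- by case: test_defined.
- by do 2 case: test_defined.
- by do 2 case: test_defined.
Qed.

Section Steps.
Variables (ss : seq (nat * tm)) (A : @access Sg disp D) (m : memory Sg D V X).

Definition access_steps : Prop :=
  [/\ forall x : V, steps (substs ss (data_def A (rank x))) (tbool (mem_dd m x)),
      forall x : V, steps (substs ss (data_val A (rank x))) (tdata (mem_dv m x)),
      forall x : X, steps (substs ss (str_def A (rank x))) (tbool (mem_sd m x))
    & forall x : X, steps (substs ss (str_val A (rank x))) (list_term (mem_sv m x))].

Hypothesis HA : access_steps.

Lemma steps_items_def s :
  steps (substs ss (items_def A (map (@raw_item _ _ _) s))) (tbool (items_defined m s)).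
Proof.
case: HA => H1 _ H3 _; elim: s => [|i s IH] /=.
  by rewrite substs_const; apply: steps_refl.
rewrite substs_if substs_const; apply: steps_and => //.
by case: i => [cv|x] /=.
Qed.

Lemma steps_items_val s :
  steps (substs ss (items_val A (map (@raw_item _ _ _) s))) (list_term (items_value m s)).
Proof.
case: HA => _ H2 _ H4; elim: s => [|i s IH] /=.
  by rewrite substs_nil; apply: steps_refl.
case: i => [cv|x] /=; last by rewrite substs_append; apply: steps_append.
rewrite substs_cons substs_pair substs_const; apply: steps_cons => //.
by apply: steps_pair => //; apply: steps_refl.
Qed.

Lemma steps_test_def phi :
  steps (substs ss (test_def A (map_test (@rank V) phi))) (tbool (test_defined m phi)).
Proof.
case: HA => H1 _ _ _; elim: phi => [||v|v|p IHp|p IHp q IHq|p IHp q IHq] //=;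
  by [rewrite substs_const; apply: steps_refl
     | rewrite substs_if substs_const; apply: steps_and].
Qed.

Lemma steps_test_val c d phi : steps (substs ss c) (tdata d) ->
  steps (substs ss (test_val A c (map_test (@rank V) phi))) (tbool (test_value m d phi)).
Proof.
case: HA => _ H2 _ _ Hc; elim: phi => [||v|v|p IHp|p IHp q IHq|p IHp q IHq] /=.
- by rewrite substs_const; apply: steps_refl.
- by rewrite substs_const; apply: steps_refl.
- by rewrite substs_lt; apply: steps_lt.
- by rewrite substs_lt; apply: steps_lt.
- by rewrite substs_isfalse; apply: steps_isfalse.
- by rewrite substs_if substs_const; apply: steps_and.
- rewrite substs_if substs_const; apply: steps_if IHp _.
  by case: test_value => //; apply: steps_refl.
Qed.

Lemma behaves_fail l : steps (substs ss l) tNil -> behaves (substs ss (fail l)) None.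
Proof.
move=> Hl; exists (tCons (tHead tNil) tNil); last by [].
rewrite substs_cons substs_head substs_nil.
exact: (steps_frame (F := F_consl tNil) isT (steps_frame (F := F_head) isT Hl)).
Qed.

Lemma behaves_out_term l (o : option (seq (item Sg V X))) :
  steps (substs ss l) tNil ->
  behaves (substs ss (out_term A l (omap (map (@raw_item _ _ _)) o)))
    (if o is Some s then if items_defined m s then Some (items_value m s) else None
     else None).
Proof.
move=> Hl; case: o => [s|] /=; last exact: behaves_fail.
rewrite substs_if; apply: behaves_if (steps_items_def s) _.
by case: items_defined; [apply: steps_items_val | apply: behaves_fail].
Qed.

End Steps.
End Memory.

(** * Configurations as argument tuples *)

Section CallArguments.
Context {Sg : finType} {disp : Order.disp_t} {D : orderType disp}.
Notation tm := (term Sg D).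
Notation tbool b := (@tConst Sg D (CBool b)).
Notation tdata d := (@tConst Sg D (CData d)).

Variable S : sdst Sg Sg.
Notation R := (raw_of S).
Notation n := (nargs R).
Notation Q := (state S).
Notation V := (dvar S).
Notation X := (svar S).
Implicit Types (m : memory Sg D V X) (b : valuation D S).

(** Same layout as [arg_types]; with [None] no state flag is true. *)
Definition vals (oq : option Q) m : seq tm :=
  [seq tbool (Some q == oq) | q <- enum Q] ++ [seq tbool (mem_dd m v) | v <- enum V]
  ++ [seq tdata (mem_dv m v) | v <- enum V] ++ [seq tbool (mem_sd m x) | x <- enum X]
  ++ [seq list_term (mem_sv m x) | x <- enum X].

Definition input w oq m : tm := tm_tuple (list_term w) (vals oq m).

Lemma size_map_enum (T : finType) (f : T -> tm) : size (map f (enum T)) = card_of T.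
Proof. by rewrite size_map size_enum. Qed.

Lemma size_vals oq m : size (vals oq m) = n.
Proof. by rewrite !size_cat !size_map_enum. Qed.

Lemma all_map_enum (T : finType) (p : pred tm) (f : T -> tm) :
  (forall x, p (f x)) -> all p (map f (enum T)).
Proof. by move=> H; rewrite all_map; apply/allP => x _ /=. Qed.

Lemma vals_value oq m : all is_value (vals oq m).
Proof. by rewrite !all_cat !all_map_enum // => x; apply: list_term_value. Qed.

Lemma subst_map_enum (T : finType) y (s : tm) (f : T -> tm) :
  (forall x, subst y s (f x) = f x) -> map (subst y s) (map f (enum T)) = map f (enum T).
Proof. by move=> H; rewrite -map_comp; apply: eq_map. Qed.

Lemma subst_vals y (s : tm) oq m : map (subst y s) (vals oq m) = vals oq m.
Proof. by rewrite /vals !map_cat !subst_map_enum // => x; apply: subst_list_term. Qed.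

Lemma subst_input y (s : tm) w oq m : subst y s (input w oq m) = input w oq m.
Proof. by rewrite /input subst_tm_tuple subst_list_term subst_vals. Qed.

Lemma nth_map_enum (T : finType) (f : T -> tm) x :
  nth tNil (map f (enum T)) (rank x) = f x.
Proof. by rewrite (nth_map x) ?nth_enum_rank // size_enum rank_lt. Qed.

Lemma nth_cat_enum (T : finType) (f : T -> tm) s k :
  nth tNil (map f (enum T) ++ s) (card_of T + k) = nth tNil s k.
Proof. by rewrite nth_cat size_map_enum ltnNge leq_addr addKn. Qed.

Lemma nth_catl_enum (T : finType) (f : T -> tm) s x :
  nth tNil (map f (enum T) ++ s) (rank x) = f x.
Proof. by rewrite nth_cat size_map_enum rank_lt nth_map_enum. Qed.

Section Accessors.
Variables (ss : seq (nat * tm)) (w : seq (Sg * D)) (oq : option Q) (m : memory Sg D V X).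
Hypothesis var0 : substs ss (tVar 0) = input w oq m.

Lemma steps_list : steps (substs ss (lref n)) (list_term w).
Proof.
rewrite -(size_vals oq m).
exact: (steps_lref (list_term_value w) (vals_value oq m)).
Qed.

Lemma steps_vals k : k < n -> steps (substs ss (component n k)) (nth tNil (vals oq m) k).
Proof.
move=> ltk; rewrite -[in component _](size_vals oq m).
by apply: (steps_comp (list_term_value w) (vals_value oq m)) => //; rewrite size_vals.
Qed.

Lemma steps_state (q : Q) : steps (substs ss (component n (rank q))) (tbool (Some q == oq)).
Proof.
have ltq : rank q < n by have := rank_lt q; rewrite /nargs /=; lia.
by have := steps_vals ltq; rewrite nth_catl_enum.
Qed.

Lemma access0_steps : access_steps ss (access0 R) m.
Proof.
by split=> x /=; have := rank_lt x => ltx;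
  [have := @steps_vals (card_of Q + rank x)
  |have := @steps_vals (card_of Q + (card_of V + rank x))
  |have := @steps_vals (card_of Q + (card_of V + (card_of V + rank x)))
  |have := @steps_vals (card_of Q + (card_of V + (card_of V + (card_of X + rank x))))];
  rewrite !nth_cat_enum ?nth_catl_enum ?nth_map_enum; apply; rewrite /nargs /=; lia.
Qed.

Definition set_mem m d : memory Sg D V X :=
  Memory (fun v => (v == curr S) || mem_dd m v)
    (fun v => if v == curr S then d else mem_dv m v) (mem_sd m) (mem_sv m).

Variables (s : Sg) (d : D).
Hypothesis var3 : substs ss (tVar 3) = tPair (tConst (CTag s)) (tdata d).

Lemma steps_head_data : steps (substs ss (tSnd (tVar 3))) (tdata d).
Proof. by rewrite substs_snd var3; apply: steps_snd (steps_refl _). Qed.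

Lemma access1_steps : access_steps ss (access1 R) (set_mem m d).
Proof.
case: access0_steps => H1 H2 H3 H4.
split=> // v; rewrite /= (inj_eq (@rank_inj _)); case: eqP => _ /=.
- by rewrite substs_const; apply: steps_refl.
- exact: H1.
- exact: steps_head_data.
- exact: H2.
Qed.

Definition enabled (t : transition Sg Sg Q V X) : bool :=
  [&& Some (src t) == oq, s == lab t, test_defined (set_mem m d) (guard t)
    & test_value (set_mem m d) d (guard t)].

Lemma steps_enabled t :
  steps (substs ss (enabled_term R (raw_of_transition t))) (tbool (enabled t)).
Proof.
rewrite /enabled_term /enabled !substs_if substs_const.
apply: steps_and; first exact: steps_state.
apply: steps_and.
  rewrite substs_istag; apply: steps_istag.
  by rewrite substs_fst var3; apply: steps_fst (steps_refl _).
by apply: steps_and;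
  [exact: steps_test_def access1_steps _
  |exact: (steps_test_val access1_steps (guard t) steps_head_data)].
Qed.

Definition next_mem (t : transition Sg Sg Q V X) : memory Sg D V X :=
  let m' := set_mem m d in
  Memory (fun v => mem_dd m' (asgn_data t v)) (fun v => mem_dv m' (asgn_data t v))
    (fun x => items_defined m' (asgn_str t x)) (fun x => items_value m' (asgn_str t x)).

Definition dead_mem : memory Sg D V X :=
  Memory (fun _ => false) (fun _ => d) (fun _ => false) (fun _ => [::]).

Lemma Forall2_steps_map_map W W' (h : W -> W') (f : W' -> tm) (g : W -> tm) r :
  (forall x, steps (substs ss (f (h x))) (g x)) ->
  List.Forall2 steps (map (substs ss) (map f (map h r))) (map g r).
Proof. by move=> H; elim: r => //= x r IH; constructor. Qed.

Lemma Forall2_steps_nseq (T : finType) (t u : tm) : steps (substs ss t) u ->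
  List.Forall2 steps (map (substs ss) (nseq (card_of T) t)) (map (fun _ : T => u) (enum T)).
Proof. by move=> H; rewrite -size_enum; elim: (enum T) => //= x r IH; constructor. Qed.

(** The optional state covers both the rank of a target state and the index [nq], which is the rank
    of none. *)
Lemma steps_state_flags k oq' : (forall q : Q, (rank q == k) = (Some q == oq')) ->
  List.Forall2 steps (map (substs ss) (state_flags R k))
    [seq tbool (Some q == oq') | q <- enum Q].
Proof.
move=> H; rewrite /state_flags -[raw_nq R]/(card_of Q) -map_rank.
by apply: Forall2_steps_map_map => q; rewrite substs_const H; apply: steps_refl.
Qed.

Lemma steps_trans_args t :
  List.Forall2 steps (map (substs ss) (trans_args R (raw_of_transition t)))
    (vals (Some (dst t)) (next_mem t)).
Proof.
case: access1_steps => H1 H2 _ _.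
rewrite /trans_args !map_cat; apply: List.Forall2_app.
  by apply: steps_state_flags => q; rewrite (inj_eq (@rank_inj _)).
do ?[apply: List.Forall2_app]; apply: Forall2_steps_map_map => x.
- exact: H1.
- exact: H2.
- exact: steps_items_def access1_steps _.
- exact: steps_items_val access1_steps _.
Qed.

Lemma steps_dead_args :
  List.Forall2 steps (map (substs ss) (dead_args R)) (vals None dead_mem).
Proof.
rewrite /dead_args !map_cat; apply: List.Forall2_app.
  by apply: steps_state_flags => q; rewrite ltn_eqF // rank_lt.
do ?[apply: List.Forall2_app].
- by apply: (@Forall2_steps_nseq V _ (tbool false)); rewrite substs_const; apply: steps_refl.
- by apply: (@Forall2_steps_nseq V _ (tdata d)); apply: steps_head_data.
- by apply: (@Forall2_steps_nseq X _ (tbool false)); rewrite substs_const; apply: steps_refl.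
- by apply: (@Forall2_steps_nseq X _ tNil); rewrite substs_nil; apply: steps_refl.
Qed.

End Accessors.
End CallArguments.

(** * Correctness *)

Section Correctness.
Context {Sg : finType} {disp : Order.disp_t} {D : orderType disp}.
Notation tm := (term Sg D).
Notation tbool b := (@tConst Sg D (CBool b)).
Notation tdata d := (@tConst Sg D (CData d)).
Notation data := (seq (Sg * D)).

Variable S : sdst Sg Sg.
Notation R := (raw_of S).
Notation n := (nargs R).
Notation Q := (state S).
Notation V := (dvar S).
Notation X := (svar S).
Implicit Types (m : memory Sg D V X) (b : valuation D S) (w : data).

(** What the letrec rule substitutes for the name of the function: a letrec whose body is the
    function itself, so that it unrolls whenever it reaches the head of an application. *)
Definition rec_term : tm :=
  let f := tFun 0 (tprod TList (arg_types R)) (body R) in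
  tLetrec 1 (TArr (tprod TList (arg_types R)) TList) f f.

Lemma subst_rec_term y (s : tm) : subst y s rec_term = rec_term.
Proof.
suff H : has_type (fun _ => None) rec_term (TArr (tprod TList (arg_types R)) TList).
  exact: subst_closed H erefl.
by apply: HT_letrec; apply: HT_fun; apply: (proj1 (body_typed _ _)).
Qed.

(** In the order of evaluation: the letrec is unrolled before the argument is passed. The let-bound
    head comes last, in [env1]. *)
Definition env0 w oq m : seq (nat * tm) := [:: (1, rec_term); (0, input w oq m)].

Definition env1 s d w oq m : seq (nat * tm) :=
  rcons (env0 ((s, d) :: w) oq m) (3, tPair (tConst (CTag s)) (tdata d)).

Definition run_term w oq m : tm := substs (env0 w oq m) (body R).

Lemma steps_call t w oq m :
  steps t (input w oq m) -> steps (tApp rec_term t) (run_term w oq m).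
Proof.
move=> Ht; pose f := tFun 0 (tprod TList (arg_types R)) (subst 1 rec_term (body R)).
apply: (@steps_trans _ _ _ _ (tApp f t)).
  apply: (steps_frame (F := F_appl t) isT).
  by apply: steps_red (steps_refl _); apply: R_letrec.
apply: steps_trans (steps_frame (F := F_appr f) isT Ht) _.
apply: steps_red (steps_refl _); apply: R_app.
by apply: tm_tuple_value; [apply: list_term_value | apply: vals_value].
Qed.

Lemma env1_var0 s d w oq m : substs (env1 s d w oq m) (tVar 0) = input ((s, d) :: w) oq m.
Proof. exact: subst_input. Qed.

Lemma behaves_call s d w oq m oq' m' args o :
  List.Forall2 steps (map (substs (env1 s d w oq m)) args) (vals oq' m') ->
  behaves (run_term w oq' m') o ->
  behaves (substs (env1 s d w oq m) (call R args)) o.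
Proof.
move=> Ha Ho; rewrite substs_let // substs_app.
have -> : substs (env1 s d w oq m) (tVar 1) = rec_term.
  exact: etrans (congr1 (subst 3 _) (subst_rec_term 0 _)) (subst_rec_term 3 _).
apply: behaves_let; apply: behaves_steps Ho; apply: steps_call.
rewrite substs_tuple; apply: steps_tuple => //; first exact: list_term_value.
  exact: vals_value.
rewrite substs_tail; apply: (@steps_tail _ _ _ _ (s, d)).
exact: (steps_list (env1_var0 s d w oq m)).
Qed.

Definition result (oq : option Q) m : option data :=
  if oq is Some q then if out S q is Some s then
    if items_defined m s then Some (items_value m s) else None else None else None.

Lemma run_term_nil oq m : behaves (run_term [::] oq m) (result oq m).
Proof.
have var0 : substs (env0 [::] oq m) (tVar 0) = input [::] oq m by [].
have Hl := steps_list var0.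
rewrite /run_term substs_if; apply: behaves_if.
  by rewrite substs_isnil; apply: (steps_isnil (l := [::])).
rewrite /= /out_terms -[raw_nq R]/(card_of Q) -map_rank.
(* The result is restricted to the states still to be tested, so that the induction can follow the
   chain of conditionals. *)
have -> : result oq m = if oq is Some q then
    if q \in enum Q then result oq m else None else None.
  by case: oq {var0 Hl} => // q; rewrite mem_enum.
elim: (enum Q) => [|q qs IH] /=; first by move: (behaves_fail Hl); case: (oq).
rewrite substs_if; apply: (behaves_if (steps_state var0 q)).
rewrite nth_raw_out; case: oq var0 Hl IH => [q'|] var0 Hl //= IH.
rewrite inE (inj_eq Some_inj) eq_sym; case: eqP => [E|_] //=; subst q'.
exact: (behaves_out_term (access0_steps var0) _ Hl).
Qed.

Lemma run_term_cons s d w oq m o :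
  behaves (substs (env1 s d w oq m) (trans_terms R)) o ->
  behaves (run_term ((s, d) :: w) oq m) o.
Proof.
have var0 : substs (env0 ((s, d) :: w) oq m) (tVar 0) = input ((s, d) :: w) oq m by [].
have Hl := steps_list var0.
apply: behaves_steps; rewrite /run_term substs_if.
apply: steps_if; first by rewrite substs_isnil; apply: steps_isnil Hl.
rewrite /= substs_let // substs_head.
apply: steps_trans (steps_frame (F := F_let 3 _) isT (steps_head Hl)) _.
by apply: steps_red (steps_refl _); apply: R_let.
Qed.

(** The conditionals try the transitions in the order of the list, so the one executed is the head
    of the filtered list. *)
Lemma trans_terms_behaves s d w oq m o :
  behaves (if [seq t <- trans S | enabled oq m s d t] is t :: _
           then run_term w (Some (dst t)) (next_mem m d t)
           else run_term w None (dead_mem S d)) o ->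
  behaves (substs (env1 s d w oq m) (trans_terms R)) o.
Proof.
have var0 := env1_var0 s d w oq m.
have var3 : substs (env1 s d w oq m) (tVar 3) = tPair (tConst (CTag s)) (tdata d) by [].
rewrite /trans_terms -[raw_trans R]/(map (@raw_of_transition _ _ _ _) (trans S)).
elim: (trans S) => [|t ts IH] /=.
  exact: behaves_call (steps_dead_args S var3).
move=> Ho; rewrite substs_if; apply: (behaves_if (steps_enabled var0 var3 t)).
case: enabled Ho => // Ho.
exact: behaves_call (steps_trans_args var0 var3 t) Ho.
Qed.

Definition rep b m : Prop :=
  represents (dval b) m /\
  forall x, Defs.sval b x = if mem_sd m x then Some (mem_sv m x) else None.

Lemma eval_str_rep b m s : rep b m ->
  eval_str b s = if items_defined m s then Some (items_value m s) else None.
Proof.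
move=> [Hd Hs]; elim: s => //= i s ->.
case: i => [[c v]|x] /=; rewrite ?Hd ?Hs.
  by case: (mem_dd m v); case: items_defined.
by case: (mem_sd m x); case: items_defined.
Qed.

Lemma rep_set_curr b m d : rep b m -> rep (set_curr b d) (set_mem m d).
Proof. by move=> [Hd Hs]; split=> // v /=; case: eqP. Qed.

Lemma rep_next b m d t : rep b m -> rep (apply_asgn (set_curr b d) t) (next_mem m d t).
Proof.
move=> /(rep_set_curr d) H; split=> [v|x] /=; last exact: eval_str_rep.
by case: H => Hd _; apply: Hd.
Qed.

Lemma enabledP b m q s d t : rep b m -> enabled (Some q) m s d t <->
  [/\ src t = q, lab t = s &
      eval_test (curr S) (dval (set_curr b d)) (guard t) = Some true].
Proof.
move=> /(rep_set_curr d) [Hd _].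
rewrite (eval_test_represents _ Hd (d := d)) /=; last by rewrite eqxx.
rewrite /enabled; split.
  by case/and4P=> /eqP[->] /eqP -> -> ->.
by case=> -> ->; rewrite !eqxx /=; case: test_defined => // -[->].
Qed.

Definition sem_from q b w (w' : data) : Prop :=
  exists q' b' s, [/\ sdst_run q b w q' b', out S q' = Some s & eval_str b' s = Some w'].

Lemma sem_from_nil q b w' :
  sem_from q b [::] w' <-> exists2 s, out S q = Some s & eval_str b s = Some w'.
Proof.
split=> [[q' [b' [s [r E1 E2]]]]|[s E1 E2]]; last by exists q, b, s; split=> //; constructor.
by inversion r; subst; exists s.
Qed.

Hypothesis S_wf : sdst_wf D S.

(** Any two enabled transitions coincide, by disjointness of the tests, so the first one found
    accounts for every run of the transducer. *)
Lemma sem_from_cons q b m s d w w' : rep b m ->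
  sem_from q b ((s, d) :: w) w' <->
  if [seq t <- trans S | enabled (Some q) m s d t] is t :: _
  then sem_from (dst t) (apply_asgn (set_curr b d) t) w w' else False.
Proof.
move=> Hr; have InF t : List.In t [seq t <- trans S | enabled (Some q) m s d t] <->
    List.In t (trans S) /\ enabled (Some q) m s d t by exact: List.filter_In.
have stepE q1 b1 : sdst_step q b (s, d) q1 b1 ->
    exists t, [/\ List.In t [seq t <- trans S | enabled (Some q) m s d t],
      q1 = dst t & b1 = apply_asgn (set_curr b d) t].
  move=> H; inversion H as [t b0 d0 tS ev Eq Eb Ea E1 E2]; exists t; split=> //.
  by rewrite Eq Ea; apply/InF; split=> //; apply/(enabledP _ _ _ _ Hr).
case: filter InF stepE => [|t ts] InF stepE.
  split=> // -[q' [b' [o [r _ _]]]].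
  by inversion r as [|? ? ? q1 b1 ? ? ? st]; subst; case: (stepE _ _ st) => t [].
have [tS /(enabledP _ _ _ _ Hr) [tq tl te]] : List.In t (trans S) /\ enabled (Some q) m s d t.
  by apply/InF; left.
split=> [[q' [b' [o [r Eo Ew]]]]|[q' [b' [o [r Eo Ew]]]]]; exists q', b', o; split=> //.
  inversion r as [|? ? ? q1 b1 ? ? ? st r1]; subst.
  case: (stepE _ _ st) => u [/InF [uS /(enabledP _ _ _ _ Hr) [uq ul ue]] E1 E2].
  suff <- : u = t by rewrite -E1 -E2.
  (* Disjointness turns [u <> t] into a contradiction; the equality follows by double negation. *)
  apply: Classical_Prop.NNPP => neq; case: S_wf => _ _ det.
  by apply: (det u t uS tS neq _ _ (dval (set_curr b d))); rewrite ?uq ?ul.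
apply: SdstRunS r; rewrite -tq -tl; exact: SdstStep.
Qed.

(** The optional state lets one induction treat live and blocked runs together: [o] is the common
    outcome of the function and the transducer, and is forced to be [None] once there is no current
    state. *)
Lemma simulation w oq b m : rep b m ->
  exists2 o, behaves (run_term w oq m) o &
    forall w', (exists2 q, oq = Some q & sem_from q b w w') <-> o = Some w'.
Proof.
elim: w oq b m => [|[s d] w IH] oq b m Hr.
  exists (result oq m); first exact: run_term_nil.
  move=> w'; split=> [[q -> /sem_from_nil [s Es]]|].
    by rewrite (eval_str_rep _ Hr) /result Es.
  case: oq => // q; rewrite /result; case Es: (out S q) => [s|//] H.
  by exists q => //; apply/sem_from_nil; exists s; rewrite // (eval_str_rep _ Hr).
have Hn t := IH (Some (dst t)) _ _ (rep_next d t Hr).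
have [o Ho Eo] : exists2 o,
    behaves (if [seq t <- trans S | enabled oq m s d t] is t :: _
           then run_term w (Some (dst t)) (next_mem m d t)
           else run_term w None (dead_mem S d)) o &
    forall w', (if [seq t <- trans S | enabled oq m s d t] is t :: _
        then sem_from (dst t) (apply_asgn (set_curr b d) t) w w' else False) <-> o = Some w'.
  case: filter => [|t _].
    (* The transducer has no configuration here; the nowhere defined valuation is the one
       represented by [dead_mem]. *)
    have [|o Ho Eo] := IH None (Valuation (fun _ => None) (fun _ => None)) (dead_mem S d).
      by split.
    by exists o => // w'; split=> // /Eo [].
  have [o Ho Eo] := Hn t; exists o => // w'; split.
    by move=> H; apply/Eo; exists (dst t).
  by move/Eo=> [q [<-]].
exists o; first by apply: run_term_cons; apply: trans_terms_behaves.
move=> w'; rewrite -Eo; split=> [[q Eq /(sem_from_cons _ _ _ _ _ Hr)]|]; first by rewrite Eq.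
case: oq {Ho Eo} => [q|] H; first by exists q => //; apply/(sem_from_cons _ _ _ _ _ Hr).
(* Without a current state no transition is enabled. *)
by move: H; rewrite (eq_filter (a2 := pred0)) ?filter_pred0.
Qed.

(** A list is a normal form and a value, so uniqueness of normal forms rules out both a second list
    and a stuck term. *)
Lemma behavesE (t : tm) o w' :
  behaves t o -> steps t (list_term w') <-> o = Some w'.
Proof.
have nf l : stepf (list_term l : tm) = None by apply: stepf_value; apply: list_term_value.
case: o => [l|] /= Ho; split=> // Ht.
- by congr Some; apply: list_term_inj; apply: steps_nf Ho Ht _ _.
- by case: Ht => <-.
case: Ho => u tu [nu /negP nv]; case: nv.
by rewrite (steps_nf tu Ht nu (nf _)) list_term_value.
Qed.

(** With no scalar arguments or results both encoded prefixes are empty, and the transduction is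
    plain evaluation on lists. *)
Lemma fun_semE (C : codec Sg D) (f : tm) w w' :
  fun_sem C [::] [::] f w w' <-> steps (tApp f (list_term w)) (list_term w').
Proof.
split=> [[[|? ?] [[|? ?] [l [[|? ?] [[|? ?] [l1]]]]]]|H]; try by case=> [[]] // ? ? ? [[]].
  by case=> [[_ _ ->] [[_ _ ->] H]].
by exists [::], [::], w, [::], [::], w'.
Qed.

Section Inhabited.
Variable d0 : D.

Definition init_mem : memory Sg D V X :=
  Memory (fun _ => false) (fun _ => d0) (fun _ => true) (fun _ => [::]).

Lemma init_args_vals : init_args R d0 = vals (Some (init_state S)) init_mem.
Proof.
have nseqE (T : finType) (t : tm) : nseq (card_of T) t = [seq t | _ <- enum T].
  by rewrite -size_enum; elim: (enum T) => //= x r ->.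
rewrite /init_args /vals; congr (_ ++ (_ ++ (_ ++ (_ ++ _)))); try exact: nseqE.
rewrite /state_flags -[raw_nq R]/(card_of Q) -map_rank -map_comp.
by apply: eq_map => q /=; rewrite (inj_eq (@rank_inj _)).
Qed.

Lemma steps_compile w :
  steps (tApp (compile (Some d0) S) (list_term w)) (run_term w (Some (init_state S)) init_mem).
Proof.
apply: steps_red; first by apply: R_app; apply: list_term_value.
rewrite /= subst_tm_tuple /= init_args_vals subst_vals.
apply: steps_red; first exact: R_letrec.
rewrite /= subst_tm_tuple subst_list_term subst_vals.
by apply: steps_call; apply: steps_refl.
Qed.

Lemma compile_correct (C : codec Sg D) w w' :
  sdst_sem S w w' <-> fun_sem C [::] [::] (compile (Some d0) S) w w'.
Proof.
have [|o Ho Eo] := @simulation w (Some (init_state S)) (init_valuation D S) init_mem.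
  by split.
rewrite fun_semE (behavesE _ (behaves_steps (steps_compile w) Ho)) -Eo.
split=> [[q [b [s H]]]|[q [<-]] //]; first by exists (init_state S) => //; exists q, b, s.
Qed.

Lemma compile_single_pass : single_pass [::] [::] (compile (Some d0) S).
Proof.
case: S_wf => _ copyless _; apply: single_pass_rec_fun.
- by rewrite !all_cat !all_nseq !orbT.
- by move=> G G0 G1; case: (body_typed (D := D) G0 G1).
- rewrite size_arg_types; pose G k := if k == 0 then Some (tprod TList (arg_types R))
    else Some (TArr (tprod TList (arg_types R)) TList).
  by case: (@body_typed Sg disp D S G erefl erefl).
- exact: single_calls_body.
have init_bool c : init_value TBool (tbool c) by exists (CBool c).
rewrite /init_args /arg_types; apply: List.Forall2_app.
  apply: List.Forall2_flip; apply: Forall2_map_nseq => [|k _]; first by rewrite size_iota.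
  exact: init_bool.
do ?[apply: List.Forall2_app]; apply: Forall2_nseq => //.
by exists (CData d0).
Qed.

End Inhabited.

(** * Empty set of data values *)

Section Empty.
Hypothesis D_empty : D -> False.

Definition is_inr (i : item Sg V X) : bool := if i is inr _ then true else false.

(** In the initial configuration every letter of an output mentions an undefined data variable, and
    every string variable is empty. *)
Definition empty_result s : option data := if all is_inr s then Some [::] else None.

Lemma eval_str_init s : eval_str (init_valuation D S) s = empty_result s.
Proof.
rewrite /empty_result.
by elim: s => [|[[c v]|x] s IH] //=; rewrite IH; case: ifP.
Qed.

Lemma compile_empty_behaves :
  behaves (tApp (compile None S) (list_term [::]))
    (if out S (init_state S) is Some s then empty_result s else None).
Proof.
pose f : tm := tFun 0 TList (body_empty R); pose L := tLetrec 1 (TArr TList TList) f f.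
pose ss : seq (nat * tm) := [:: (1, L); (0, tNil)].
apply: (@behaves_steps _ _ _ _ (substs ss (body_empty R))).
  apply: steps_red; first exact: R_app.
  apply: steps_red; first exact: R_letrec.
  apply: (@steps_trans _ _ _ _ (tApp (tFun 0 TList (subst 1 L (body_empty R))) tNil)).
    apply: (steps_frame (F := F_appl tNil) isT).
    by apply: steps_red (steps_refl _); apply: R_letrec.
  by apply: steps_red (steps_refl _); apply: R_app.
rewrite /body_empty nth_raw_out.
have Hf : behaves (substs ss (fail (tVar 0))) None by apply: behaves_fail; apply: steps_refl.
case: (out S (init_state S)) => [s|] //=.
set A := Access _ _ _ _; rewrite substs_if.
have Hd : steps (substs ss (items_def A (map (@raw_item _ _ _) s))) (tbool (all is_inr s)).
  elim: s => [|i s IH] /=; first by rewrite substs_const; apply: steps_refl.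
  rewrite substs_if substs_const; apply: steps_and IH.
  by case: i => [cv|x]; rewrite substs_const; apply: steps_refl.
apply: (behaves_if Hd); rewrite /empty_result; case Es: (all is_inr s) => //= {Hd}.
elim: s Es => [|[cv|x] s IH] //= Es; first by rewrite substs_nil; apply: steps_refl.
rewrite substs_append substs_nil.
exact: (steps_append (l := [::]) (m := [::]) (steps_refl _) (IH Es)).
Qed.

Lemma compile_empty_correct (C : codec Sg D) w w' :
  sdst_sem S w w' <-> fun_sem C [::] [::] (compile None S) w w'.
Proof.
have -> : w = [::] by case: w => [//|[? d] ?]; case: (D_empty d).
rewrite fun_semE (behavesE _ compile_empty_behaves).
rewrite -[sdst_sem _ _ _]/(sem_from _ _ _ _) sem_from_nil.
case: (out S _) => [s|]; split=> //; last by case.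
  by case=> _ [<-]; rewrite eval_str_init.
by move=> H; exists s; rewrite // eval_str_init.
Qed.

Lemma compile_empty_single_pass : single_pass [::] [::] (compile None S : tm).
Proof.
pose G0 k := if k == 0 then Some TList else None.
have H G : G 0 = Some TList -> expr G 0 TList (body_empty R : tm).
  move=> Gx; have Gx' : exists2 Ts, size Ts = 0 & G 0 = Some (tprod TList Ts) by exists [::].
  rewrite /body_empty nth_raw_out; apply: (expr_out_term Gx') => ?.
  - exact: expr_bool.
  - exact: expr_snd (expr_head Gx').
  - exact: expr_bool.
  - exact: expr_nil.
apply: single_pass_rec_fun => //.
- by move=> G' /H [].
- by case: (H G0 erefl) => _ /simple_body.
- by apply: SC_plain; case: (H G0 erefl) => _ /simple_free.
Qed.

End Empty.
End Correctness.

Theorem proposition9 (Sg : finType) (disp : Order.disp_t) (D : orderType disp)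
    (C : codec Sg D) :
  exists compile : sdst Sg Sg -> term Sg D,
    computable (@enc_sdst D Sg Sg) (@enc_term Sg disp D) compile /\
    forall S : sdst Sg Sg, sdst_wf D S ->
      exists T1 T : seq ty,
        single_pass T1 T (compile S) /\
        forall w w' : seq (Sg * D),
          sdst_sem S w w' <-> fun_sem C T1 T (compile S) w w'.
Proof.
(* The classical case distinction comes before the choice of the translation, so no program has to
   decide it. *)
have [[d]|D_empty] := Classical_Prop.classic (inhabited D).
  exists (compile (Some d)); split=> [|S wf]; first exact: computable_compile.
  exists [::], [::]; split=> [|w w']; first exact: compile_single_pass.
  exact: compile_correct.
exists (compile None); split=> [|S wf]; first exact: computable_compile.
exists [::], [::]; split=> [|w w']; first exact: compile_empty_single_pass.
by apply: compile_empty_correct => d; apply: D_empty.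
Qed.
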